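(* Let $\Lambda=\begin{pmatrix} A & N \\ M & B \end{pmatrix}$ be a Morita ring which is an Artin algebra, with $M\otimes_A N=0=N\otimes_B M$. Assume that ${}_BM$, ${}_AN$, $M_A$ and $N_B$ are projective modules. Let $\begin{pmatrix} X \\ Y \end{pmatrix}_{f,g}$ be a left $\Lambda$-module. Then $\begin{pmatrix} X \\ Y \end{pmatrix}_{f,g}$ is a Gorenstein-projective $\Lambda$-module if and only if it is monic, $\operatorname{Coker}f$ is a Gorenstein-projective left $B$-module and $\operatorname{Coker}g$ is a Gorenstein-projective left $A$-module.
   Context: All modules are finitely generated. $A$ and $B$ are Artin $R$-algebras over a commutative artinian ring $R$; ${}_BM_A$ and ${}_AN_B$ are bimodules, finitely generated over $R$, on which $R$ acts centrally. A Morita ring $\Lambda$ is the set of matrices $\begin{pmatrix} a & n \\ m & b \end{pmatrix}$ with multiplication defined using bimodule maps $\phi:M\otimes_AN\to B$ and $\psi:N\otimes_BM\to A$; since here $M\otimes_AN=0=N\otimes_BM$, $\phi=0=\psi$ and $$\begin{pmatrix} a & n \\ m & b \end{pmatrix}\begin{pmatrix} a' & n' \\ m' & b' \end{pmatrix}=\begin{pmatrix} aa' & an'+nb' \\ ma'+bm' & bb' \end{pmatrix}.$$ A left $\Lambda$-module is identified with a quadruple $\begin{pmatrix} X \\ Y \end{pmatrix}_{f,g}$, where $X$ is a left $A$-module, $Y$ a left $B$-module, $f\in\operatorname{Hom}_B(M\otimes_AX,Y)$ and $g\in\operatorname{Hom}_A(N\otimes_BY,X)$. It is called monic if both $f:M\otimes_AX\to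 Y$ and $g:N\otimes_BY\to X$ are injective. A left module $G$ over an Artin algebra $R'$ is Gorenstein-projective if there is an acyclic complex $P^\bullet:\cdots\to P^{-1}\to P^0\xrightarrow{d_0}P^1\to\cdots$ of finitely generated projective left $R'$-modules such that $\operatorname{Hom}_{R'}(P^\bullet,P)$ is acyclic for every finitely generated projective $P$, and $G\cong\operatorname{Ker}d_0$. *)

(* Defs.v *)
From HB Require Import structures.
From mathcomp Require Import all_boot all_algebra.
From mathcomp Require Import boolp.
From mathcomp Require Import freeg.

Set Implicit Arguments.
Unset Strict Implicit.
Unset Printing Implicit Defensive.

Import GRing.Theory.
Local Open Scope ring_scope.
Local Open Scope quotient_scope.

Definition fg (S : pzRingType) (V : lmodType S) : Prop :=
  exists (n : nat) (e : 'I_n -> V),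
    forall v, exists c : 'I_n -> S, v = \sum_(i < n) c i *: e i.

Definition projective (S : pzRingType) (P : lmodType S) : Prop :=
  forall (V W : lmodType S) (p : {linear V -> W}) (h : {linear P -> W}),
    (forall w, exists v, p v = w) ->
    exists k : {linear P -> V}, forall x, p (k x) = h x.

Definition zero_module (S : pzRingType) (V : lmodType S) : Prop :=
  forall v : V, v = 0.

Definition is_ideal (R : comNzRingType) (I : R -> Prop) : Prop :=
  I 0 /\ forall a x y, I x -> I y -> I (a * x + y).

Definition artinian (R : comNzRingType) : Prop :=
  forall I : nat -> R -> Prop,
    (forall n, is_ideal (I n)) -> (forall n x, I n.+1 x -> I n x) ->
    exists n, forall m, (n <= m)%N -> forall x, I m x <-> I n x.

Definition artin_algebra (R : comNzRingType) (A : algType R) : Prop :=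
  artinian R /\ fg A.

Section Kernel.
Variables (S : pzRingType) (V W : lmodType S) (f : {linear V -> W}).

Definition ker_pred : {pred V} := fun v => f v == 0.

Lemma ker_pred_closed : subsemimod_closed ker_pred.
Proof.
split; first split; rewrite ?/ker_pred /in_mem /= ?linear0 //.
  move=> x y; rewrite /ker_pred /in_mem /= => /eqP fx /eqP fy.
  by rewrite linearD fx fy addr0.
move=> a x; rewrite /ker_pred /in_mem /= => /eqP fx.
by rewrite linearZ_LR fx scaler0.
Qed.

HB.instance Definition _ := GRing.isSubmodClosed.Build S V ker_pred
  ker_pred_closed.

Record ker : Type := Ker { ker_val : V; _ : ker_val \in ker_pred }.

HB.instance Definition _ := [isSub for ker_val].
HB.instance Definition _ := [Choice of ker by <:].
HB.instance Definition _ := [SubChoice_isSubLmodule of ker by <:].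

End Kernel.

Section Cokernel.
Variables (S : pzRingType) (V W : lmodType S) (f : {linear V -> W}).

Definition im_pred : {pred W} := fun w => `[< exists v, f v = w >].

Lemma im_pred_closed : zmod_closed im_pred.
Proof.
split; first by apply/asboolP; exists 0; rewrite linear0.
move=> _ _ /asboolP[x <-] /asboolP[y <-].
by apply/asboolP; exists (x - y); rewrite linearB.
Qed.

HB.instance Definition _ := GRing.isZmodClosed.Build W im_pred im_pred_closed.

Lemma im_predZ a w : w \in im_pred -> a *: w \in im_pred.
Proof.
by move=> /asboolP[v <-]; apply/asboolP; exists (a *: v); rewrite linearZ_LR.
Qed.

Definition coker : Type := Quotient.quot im_pred.
HB.instance Definition _ := GRing.Zmodule.on coker.

Definition coker_proj (w : W) : coker := \pi_(Quotient.quot im_pred) w.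
Definition coker_scale (a : S) (t : coker) : coker :=
  coker_proj (a *: repr (t : Quotient.quot im_pred)).

Lemma coker_projP w w' :
  coker_proj w = coker_proj w' <-> exists v, f v = w - w'.
Proof.
rewrite /coker_proj; split.
  by move/eqP; rewrite -Quotient.idealrBE => /asboolP.
by move=> h; apply/eqP; rewrite -Quotient.idealrBE; apply/asboolP.
Qed.

Lemma coker_projD : {morph coker_proj : x y / x + y}.
Proof. by move=> x y; rewrite /coker_proj raddfD. Qed.

Lemma coker_projK (t : coker) :
  coker_proj (repr (t : Quotient.quot im_pred)) = t.
Proof. exact: reprK. Qed.

Lemma coker_scaleE a w : coker_scale a (coker_proj w) = coker_proj (a *: w).
Proof.
apply/eqP; rewrite /coker_scale /coker_proj -Quotient.idealrBE -scalerBr.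
by apply: im_predZ; rewrite Quotient.idealrBE reprK.
Qed.

Lemma coker_scaleA a b t :
  coker_scale a (coker_scale b t) = coker_scale (a * b) t.
Proof. by rewrite -(coker_projK t) !coker_scaleE scalerA. Qed.
Lemma coker_scale1 : left_id 1 coker_scale.
Proof. by move=> t; rewrite -(coker_projK t) coker_scaleE scale1r. Qed.
Lemma coker_scaleDr : right_distributive coker_scale +%R.
Proof.
move=> a t u; rewrite -(coker_projK t) -(coker_projK u).
by rewrite -coker_projD !coker_scaleE scalerDr coker_projD.
Qed.
Lemma coker_scaleDl t : {morph coker_scale^~ t : a b / a + b}.
Proof.
move=> a b; rewrite -(coker_projK t).
by rewrite !coker_scaleE scalerDl coker_projD.
Qed.

HB.instance Definition _ := GRing.Zmodule_isLmodule.Build S coker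
  coker_scaleA coker_scale1 coker_scaleDr coker_scaleDl.

End Cokernel.

(* The index i + 1 runs through all integers, so the conditions at i + 1      *)
(* below are exactness at every spot (and include d \o d = 0).                *)

Definition acyclic (S : pzRingType) (P : int -> lmodType S)
    (d : forall i : int, {linear P i -> P (i + 1)}) : Prop :=
  forall (i : int) (x : P (i + 1)),
    d (i + 1) x = 0 <-> exists y, d i y = x.

Definition hom_acyclic (S : pzRingType) (P : int -> lmodType S)
    (d : forall i : int, {linear P i -> P (i + 1)}) (Q : lmodType S) : Prop :=
  forall (i : int) (h : {linear P (i + 1) -> Q}),
    (forall x, h (d i x) = 0) <->
    exists k : {linear P (i + 1 + 1) -> Q}, forall x, k (d (i + 1) x) = h x.

Definition gorenstein_projective (S : pzRingType) (G : lmodType S) : Prop :=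
  exists (P : int -> lmodType S) (d : forall i, {linear P i -> P (i + 1)}),
    [/\ forall i, fg (P i) /\ projective (P i),
        acyclic d,
        forall Q : lmodType S, fg Q -> projective Q -> hom_acyclic d Q
      & exists j : {linear G -> ker (d 0)}, bijective j].

(* B-A-bimodules on which R acts centrally: a left B-module with a commuting  *)
(* right A-action such that both actions induce the same R-action.            *)

HB.mixin Record Lmodule_isBimodule (R : comNzRingType) (B A : algType R) M
    of GRing.Lmodule B M := {
  ract : M -> A -> M;
  ractA : forall m a a', ract (ract m a) a' = ract m (a * a');
  ract1 : forall m, ract m 1 = m;
  ractDl : forall m m' a, ract (m + m') a = ract m a + ract m' a;
  ractDr : forall m a a', ract m (a + a') = ract m a + ract m a';
  scale_ract : forall b m a, b *: ract m a = ract (b *: m) a;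
  ract_central : forall (r : R) m, r%:A *: m = ract m r%:A
}.

#[short(type="bimodType")]
HB.structure Definition Bimodule (R : comNzRingType) (B A : algType R) :=
  {M of Lmodule_isBimodule R B A M & GRing.Lmodule B M}.

Lemma ract0l (R : comNzRingType) (B A : algType R) (M : bimodType B A) a :
  ract (0 : M) a = 0.
Proof. by apply: (addrI (ract 0 a)); rewrite -ractDl !addr0. Qed.

(* The underlying right A-module, as a left module over the opposite ring.    *)
Definition right_mod (R : comNzRingType) (B A : algType R)
  (M : bimodType B A) : Type := M.

Section RightModule.
Variables (R : comNzRingType) (B A : algType R) (M : bimodType B A).

HB.instance Definition _ := GRing.Zmodule.on (right_mod M).

Definition right_scale (a : A^c) (m : right_mod M) : right_mod M :=
  ract (m : M) a.

Lemma right_scaleA a b m :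
  right_scale a (right_scale b m) = right_scale (a * b) m.
Proof. exact: ractA. Qed.
Lemma right_scale1 : left_id 1 right_scale.
Proof. exact: ract1. Qed.
Lemma right_scaleDr : right_distributive right_scale +%R.
Proof. by move=> a m m'; apply: ractDl. Qed.
Lemma right_scaleDl m : {morph right_scale^~ m : a b / a + b}.
Proof. by move=> a b; apply: ractDr. Qed.

HB.instance Definition _ := GRing.Zmodule_isLmodule.Build A^c (right_mod M)
  right_scaleA right_scale1 right_scaleDr right_scaleDl.

End RightModule.

(* Restriction of scalars of a left B-module to the base ring R.              *)
Definition base_mod (R : comNzRingType) (B : algType R) (V : lmodType B) : Type
  := V.

Section BaseModule.
Variables (R : comNzRingType) (B : algType R) (V : lmodType B).

HB.instance Definition _ := GRing.Zmodule.on (base_mod V).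

Definition base_scale (r : R) (v : base_mod V) : base_mod V :=
  (r%:A : B) *: (v : V).

Lemma base_scaleA r s v : base_scale r (base_scale s v) = base_scale (r * s) v.
Proof. by rewrite /base_scale !scalerA mulr_algl scalerA. Qed.
Lemma base_scale1 : left_id 1 base_scale.
Proof. by move=> v; rewrite /base_scale !scale1r. Qed.
Lemma base_scaleDr : right_distributive base_scale +%R.
Proof. by move=> r u v; apply: scalerDr. Qed.
Lemma base_scaleDl v : {morph base_scale^~ v : r s / r + s}.
Proof. by move=> r s; rewrite /base_scale !scalerDl. Qed.

HB.instance Definition _ := GRing.Zmodule_isLmodule.Build R (base_mod V)
  base_scaleA base_scale1 base_scaleDr base_scaleDl.

End BaseModule.


(* The tensor product M (x)_A X, with its left B-module structure: the free   *)
(* abelian group on M * X modulo the subgroup generated by the usual          *)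
(* relations.                                                                 *)

Lemma freeg_additive_ext (K : choiceType) (Z : zmodType)
    (g h : {additive {freeg K} -> Z}) :
  (forall x, g << x >> = h << x >>) -> g =1 h.
Proof.
move=> gh; elim/freeg_ind_dom0 => [|k x D _ _ IH]; first by rewrite !raddf0.
rewrite !raddfD IH; congr (_ + _).
have -> : << k *g x >> = << x >> *~ k :> {freeg K}.
  by rewrite freegU_mulz intz.
by rewrite !raddfMz gh.
Qed.

Section Tensor.
Variables (R : comNzRingType) (B A : algType R).
Variables (M : bimodType B A) (X : lmodType A).

Local Notation F := {freeg (M * X)%type}.
Local Notation "[ m , x ]" := (<< (m, x) >> : F).

Inductive tensor_rel : F -> Prop :=
| tensor_rel0 : tensor_rel 0
| tensor_relB u v : tensor_rel u -> tensor_rel v -> tensor_rel (u - v)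
| tensor_rel_addl m m' x : tensor_rel ([m + m', x] - [m, x] - [m', x])
| tensor_rel_addr m x x' : tensor_rel ([m, x + x'] - [m, x] - [m, x'])
| tensor_rel_mid m a x : tensor_rel ([ract m a, x] - [m, a *: x]).

Definition tensor_pred : {pred F} := fun u => `[< tensor_rel u >].

Lemma tensor_pred_closed : zmod_closed tensor_pred.
Proof.
split; first by apply/asboolP; apply: tensor_rel0.
by move=> u v /asboolP hu /asboolP hv; apply/asboolP; apply: tensor_relB.
Qed.

HB.instance Definition _ := GRing.isZmodClosed.Build F tensor_pred
  tensor_pred_closed.

Definition tensor : Type := Quotient.quot tensor_pred.
HB.instance Definition _ := GRing.Zmodule.on tensor.

Definition tensor_proj (u : F) : tensor := \pi_(Quotient.quot tensor_pred) u.

Definition tens (m : M) (x : X) : tensor := tensor_proj [m, x].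

Definition tensor_act (b : B) : F -> F :=
  fglift (fun p => [b *: p.1, p.2]).

Definition tensor_scale (b : B) (t : tensor) : tensor :=
  tensor_proj (tensor_act b (repr (t : Quotient.quot tensor_pred))).

Lemma tensor_projP u v : tensor_proj u = tensor_proj v <-> tensor_rel (u - v).
Proof.
rewrite /tensor_proj; split.
  by move/eqP; rewrite -Quotient.idealrBE => /asboolP.
by move=> h; apply/eqP; rewrite -Quotient.idealrBE; apply/asboolP.
Qed.

Lemma tensor_proj_is_additive : zmod_morphism tensor_proj.
Proof. by move=> u v; rewrite /tensor_proj raddfB. Qed.
HB.instance Definition _ := GRing.isZmodMorphism.Build F tensor tensor_proj
  tensor_proj_is_additive.

Lemma tensor_projK (t : tensor) :
  tensor_proj (repr (t : Quotient.quot tensor_pred)) = t.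
Proof. exact: reprK. Qed.

Lemma tensDl m m' x : tens (m + m') x = tens m x + tens m' x.
Proof.
rewrite /tens -raddfD; apply/tensor_projP.
by rewrite opprD addrA; apply: tensor_rel_addl.
Qed.

Lemma tensDr m x x' : tens m (x + x') = tens m x + tens m x'.
Proof.
rewrite /tens -raddfD; apply/tensor_projP.
by rewrite opprD addrA; apply: tensor_rel_addr.
Qed.

Lemma tens_mid m a x : tens (ract m a) x = tens m (a *: x).
Proof. by apply/tensor_projP; apply: tensor_rel_mid. Qed.

Lemma tensor_ext (Z : zmodType) (g h : {additive tensor -> Z}) :
  (forall m x, g (tens m x) = h (tens m x)) -> g =1 h.
Proof.
move=> gh t; rewrite -(tensor_projK t).
by apply: (@freeg_additive_ext _ _ (g \o tensor_proj) (h \o tensor_proj))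
  => -[m x]; apply: gh.
Qed.

Lemma tensor_lift (Z : zmodType) (beta : M -> X -> Z) :
  (forall m m' x, beta (m + m') x = beta m x + beta m' x) ->
  (forall m x x', beta m (x + x') = beta m x + beta m x') ->
  (forall m a x, beta (ract m a) x = beta m (a *: x)) ->
  exists h : {additive tensor -> Z}, forall m x, h (tens m x) = beta m x.
Proof.
move=> bDl bDr bm.
pose g : F -> Z := @fglift _ (zmodule Z) _ (fun p => beta p.1 p.2).
have gB : zmod_morphism g by apply: (@lift_is_additive _ _ (zmodule Z)).
have gE m x : g [m, x] = beta m x.
  by rewrite /g (@liftU _ (zmodule Z)) scale1r.
have grel u : tensor_rel u -> g u = 0.
  elim=> {u} [|u v _ gu _ gv|m m' x|m x x'|m a x].
  - by have := gB 0 0; rewrite !subrr.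
  - by rewrite gB gu gv subrr.
  - by rewrite !gB !gE bDl addrAC addrK subrr.
  - by rewrite !gB !gE bDr addrAC addrK subrr.
  - by rewrite gB !gE bm subrr.
pose h (t : tensor) := g (repr (t : Quotient.quot tensor_pred)).
have hE u : h (tensor_proj u) = g u.
  by apply/eqP; rewrite -subr_eq0 -gB grel //; apply/tensor_projP/tensor_projK.
have hB : zmod_morphism h.
  move=> t t'; rewrite -(tensor_projK t) -(tensor_projK t') -raddfB !hE.
  exact: gB.
pose hm := GRing.isZmodMorphism.Build tensor Z h hB.
pose H : {additive tensor -> Z} := HB.pack h hm.
by exists H => m x; rewrite /H /= hE.
Qed.

Lemma tensor_act_is_additive b : zmod_morphism (tensor_act b).
Proof. exact: lift_is_additive. Qed.
HB.instance Definition _ b := GRing.isZmodMorphism.Build F F (tensor_act b)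
  (tensor_act_is_additive b).

Lemma tensor_actE b m x : tensor_act b [m, x] = [b *: m, x].
Proof. by rewrite /tensor_act liftU scale1r. Qed.

Lemma tensor_act_rel b u : tensor_rel u -> tensor_rel (tensor_act b u).
Proof.
elim=> {u} [|u v _ gu _ gv|m m' x|m x x'|m a x].
- by rewrite raddf0; apply: tensor_rel0.
- by rewrite raddfB; apply: tensor_relB.
- by rewrite !raddfB /= !tensor_actE scalerDr; apply: tensor_rel_addl.
- by rewrite !raddfB /= !tensor_actE; apply: tensor_rel_addr.
- by rewrite !raddfB /= !tensor_actE scale_ract; apply: tensor_rel_mid.
Qed.

Lemma tensor_scale_proj b u :
  tensor_scale b (tensor_proj u) = tensor_proj (tensor_act b u).
Proof.
apply/tensor_projP; rewrite -raddfB; apply: tensor_act_rel.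
exact/tensor_projP/tensor_projK.
Qed.

Lemma tensor_scale_tens b m x : tensor_scale b (tens m x) = tens (b *: m) x.
Proof. by rewrite tensor_scale_proj tensor_actE. Qed.

Lemma tensor_scale_is_additive b : zmod_morphism (tensor_scale b).
Proof.
move=> t t'; rewrite -(tensor_projK t) -(tensor_projK t').
by rewrite -raddfB !tensor_scale_proj !raddfB.
Qed.
HB.instance Definition _ b := GRing.isZmodMorphism.Build tensor tensor
  (tensor_scale b) (tensor_scale_is_additive b).

Lemma tensor_scaleA b c t :
  tensor_scale b (tensor_scale c t) = tensor_scale (b * c) t.
Proof.
apply: (@tensor_ext _ (tensor_scale b \o tensor_scale c)) => m x /=.
by rewrite !tensor_scale_tens scalerA.
Qed.
Lemma tensor_scale1 : left_id 1 tensor_scale.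
Proof.
apply: (@tensor_ext _ (tensor_scale 1) idfun) => m x /=.
by rewrite tensor_scale_tens scale1r.
Qed.
Lemma tensor_scaleDr : right_distributive tensor_scale +%R.
Proof. by move=> b t u; rewrite raddfD. Qed.
Lemma tensor_scaleDl t : {morph tensor_scale^~ t : b c / b + c}.
Proof.
move=> b c; rewrite /=.
apply: (@tensor_ext _ _ (tensor_scale b \+ tensor_scale c)) => m x /=.
by rewrite !tensor_scale_tens scalerDl tensDl.
Qed.

HB.instance Definition _ := GRing.Zmodule_isLmodule.Build B tensor
  tensor_scaleA tensor_scale1 tensor_scaleDr tensor_scaleDl.

Lemma tensZl b m x : tens (b *: m) x = b *: tens m x.
Proof. by rewrite -tensor_scale_tens. Qed.

End Tensor.

(* The Morita ring with zero bimodule maps phi and psi. The matrix with rows  *)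
(* (a, n) and (m, b) is encoded as ((a, n), (m, b)); base_mod only provides   *)
(* the R-module structures of N and M.                                        *)

Definition morita (R : comNzRingType) (A B : algType R)
    (N : bimodType A B) (M : bimodType B A) : Type :=
  ((A * base_mod N) * (base_mod M * B))%type.

Section Morita.
Variables (R : comNzRingType) (A B : algType R).
Variables (N : bimodType A B) (M : bimodType B A).

HB.instance Definition _ := GRing.Lmodule.on (morita N M).

Definition mmx (a : A) (n : N) (m : M) (b : B) : morita N M := ((a, n), (m, b)).
Definition m11 (u : morita N M) : A := u.1.1.
Definition m12 (u : morita N M) : N := u.1.2.
Definition m21 (u : morita N M) : M := u.2.1.
Definition m22 (u : morita N M) : B := u.2.2.

Definition morita_one : morita N M := mmx 1 0 0 1.

Definition morita_mul (u v : morita N M) : morita N M :=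
  mmx (m11 u * m11 v)
      (m11 u *: m12 v + ract (m12 u) (m22 v))
      (ract (m21 u) (m11 v) + m22 u *: m21 v)
      (m22 u * m22 v).


Lemma morita_eq (u v : morita N M) :
  m11 u = m11 v -> m12 u = m12 v -> m21 u = m21 v -> m22 u = m22 v -> u = v.
Proof.
case: u v => [[a n] [m b]] [[a' n'] [m' b']].
by rewrite /m11 /m12 /m21 /m22 /= => -> -> -> ->.
Qed.

Lemma m11_mmx a n m b : m11 (mmx a n m b) = a. Proof. by []. Qed.
Lemma m12_mmx a n m b : m12 (mmx a n m b) = n. Proof. by []. Qed.
Lemma m21_mmx a n m b : m21 (mmx a n m b) = m. Proof. by []. Qed.
Lemma m22_mmx a n m b : m22 (mmx a n m b) = b. Proof. by []. Qed.
Definition mmxE := (m11_mmx, m12_mmx, m21_mmx, m22_mmx).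

Lemma morita_mulA : associative morita_mul.
Proof.
move=> u v w; apply: morita_eq; rewrite /morita_mul !mmxE.
- exact: mulrA.
- by rewrite scalerDr scalerA ractDl scale_ract ractA addrA.
- by rewrite scalerDr scalerA ractDl scale_ract ractA addrA.
- exact: mulrA.
Qed.

Lemma morita_mul1r : left_id morita_one morita_mul.
Proof.
move=> u; apply: morita_eq; rewrite /morita_mul /morita_one !mmxE.
- exact: mul1r.
- by rewrite scale1r ract0l addr0.
- by rewrite scale1r ract0l add0r.
- exact: mul1r.
Qed.

Lemma morita_mulr1 : right_id morita_one morita_mul.
Proof.
move=> u; apply: morita_eq; rewrite /morita_mul /morita_one !mmxE.
- exact: mulr1.
- by rewrite scaler0 ract1 add0r.
- by rewrite scaler0 ract1 addr0.
- exact: mulr1.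
Qed.

Lemma morita_mulDl : left_distributive morita_mul +%R.
Proof.
move=> u v w; apply: morita_eq; rewrite /morita_mul !mmxE.
- exact: mulrDl.
- by rewrite scalerDl ractDl addrACA.
- by rewrite scalerDl ractDl addrACA.
- exact: mulrDl.
Qed.

Lemma morita_mulDr : right_distributive morita_mul +%R.
Proof.
move=> u v w; apply: morita_eq; rewrite /morita_mul !mmxE.
- exact: mulrDr.
- by rewrite scalerDr ractDr addrACA.
- by rewrite scalerDr ractDr addrACA.
- exact: mulrDr.
Qed.

Lemma morita_one_neq0 : morita_one != 0.
Proof.
by apply/eqP => /(congr1 (fun u => m11 u)) /eqP; apply/negP/oner_neq0.
Qed.

HB.instance Definition _ := GRing.Zmodule_isNzRing.Build (morita N M)
  morita_mulA morita_mul1r morita_mulr1 morita_mulDl morita_mulDr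
  morita_one_neq0.

Lemma morita_scalerAl (r : R) (u v : morita N M) : r *: (u * v) = (r *: u) * v.
Proof.
apply: morita_eq.
- exact: scalerAl.
- change (r%:A *: (m11 u *: m12 v + ract (m12 u) (m22 v)) =
    (r *: m11 u) *: m12 v + ract (r%:A *: m12 u) (m22 v)).
  by rewrite scalerDr scalerA mulr_algl scale_ract.
- change (r%:A *: (ract (m21 u) (m11 v) + m22 u *: m21 v) =
    ract (r%:A *: m21 u) (m11 v) + (r *: m22 u) *: m21 v).
  by rewrite scalerDr scalerA mulr_algl scale_ract.
- exact: scalerAl.
Qed.

HB.instance Definition _ := GRing.Lmodule_isLalgebra.Build R (morita N M)
  morita_scalerAl.

Lemma morita_scalerAr (r : R) (u v : morita N M) : r *: (u * v) = u * (r *: v).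
Proof.
apply: morita_eq.
- exact: scalerAr.
- change (r%:A *: (m11 u *: m12 v + ract (m12 u) (m22 v)) =
    m11 u *: (r%:A *: m12 v) + ract (m12 u) (r *: m22 v)).
  by rewrite scalerDr !scalerA mulr_algl mulr_algr ract_central ractA mulr_algr.
- change (r%:A *: (ract (m21 u) (m11 v) + m22 u *: m21 v) =
    ract (m21 u) (r *: m11 v) + m22 u *: (r%:A *: m21 v)).
  by rewrite scalerDr !scalerA mulr_algl mulr_algr ract_central ractA mulr_algr.
- exact: scalerAr.
Qed.

HB.instance Definition _ := GRing.Lalgebra_isAlgebra.Build R (morita N M)
  morita_scalerAr.

End Morita.

Definition quad_monic (R : comNzRingType) (A B : algType R)
    (N : bimodType A B) (M : bimodType B A) (X : lmodType A) (Y : lmodType B)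
    (f : {linear tensor M X -> Y}) (g : {linear tensor N Y -> X}) : Prop :=
  injective f /\ injective g.

(* The left module over the Morita ring given by the quadruple (X, Y)_(f, g). *)
(* The hypotheses on M (x)_A N and N (x)_B M are what makes the action        *)
(* associative.                                                               *)

Definition quad_mod (R : comNzRingType) (A B : algType R)
    (N : bimodType A B) (M : bimodType B A)
    (MN0 : zero_module (tensor M N)) (NM0 : zero_module (tensor N M))
    (X : lmodType A) (Y : lmodType B)
    (f : {linear tensor M X -> Y}) (g : {linear tensor N Y -> X}) : Type :=
  (X * Y)%type.

Section QuadMod.
Variables (R : comNzRingType) (A B : algType R).
Variables (N : bimodType A B) (M : bimodType B A).
Variables (MN0 : zero_module (tensor M N)) (NM0 : zero_module (tensor N M)).
Variables (X : lmodType A) (Y : lmodType B).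
Variables (f : {linear tensor M X -> Y}) (g : {linear tensor N Y -> X}).

Local Notation Q := (quad_mod MN0 NM0 f g).

HB.instance Definition _ := GRing.Zmodule.on Q.

Definition quad_scale (u : morita N M) (q : Q) : Q :=
  (m11 u *: q.1 + g (tens (m12 u) q.2), f (tens (m21 u) q.1) + m22 u *: q.2).

Lemma quad_fg0 m n y : f (tens m (g (tens n y))) = 0.
Proof.
pose beta (m : M) (n : N) := f (tens m (g (tens n y))).
have [|||h hE] := @tensor_lift _ _ _ M N _ beta; rewrite /beta.
- by move=> *; rewrite tensDl linearD.
- by move=> *; rewrite tensDl linearD tensDr linearD.
- by move=> *; rewrite tens_mid tensZl linearZ_LR.
by rewrite -[LHS]/(beta m n) -hE (MN0 (tens m n)) raddf0.
Qed.

Lemma quad_gf0 n m x : g (tens n (f (tens m x))) = 0.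
Proof.
pose beta (n : N) (m : M) := g (tens n (f (tens m x))).
have [|||h hE] := @tensor_lift _ _ _ N M _ beta; rewrite /beta.
- by move=> *; rewrite tensDl linearD.
- by move=> *; rewrite tensDl linearD tensDr linearD.
- by move=> *; rewrite tens_mid tensZl linearZ_LR.
by rewrite -[LHS]/(beta n m) -hE (NM0 (tens n m)) raddf0.
Qed.

Lemma quad_scaleA u v q : quad_scale u (quad_scale v q) = quad_scale (u * v) q.
Proof.
rewrite /quad_scale.
have -> : u * v = morita_mul u v by [].
rewrite /morita_mul !mmxE; congr (_, _); rewrite /fst /snd.
- rewrite tensDr tensDl tens_mid tensZl !linearD linearZ_LR quad_gf0 add0r.
  by rewrite scalerDr scalerA addrA.
- rewrite tensDr tensDl tens_mid tensZl !linearD linearZ_LR quad_fg0 addr0.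
  by rewrite scalerDr scalerA addrA.
Qed.

Lemma tens0l (C D : algType R) (P : bimodType C D) (V : lmodType D) (v : V) :
  tens (0 : P) v = 0.
Proof. by apply: (addrI (tens 0 v)); rewrite -tensDl !addr0. Qed.

Lemma quad_scale1 : left_id 1 quad_scale.
Proof.
case=> x y; rewrite /quad_scale; congr (_, _) => /=.
- by rewrite tens0l linear0 scale1r addr0.
- by rewrite tens0l linear0 scale1r add0r.
Qed.

Lemma quad_scaleDr : right_distributive quad_scale +%R.
Proof.
move=> u p q; rewrite /quad_scale; congr (_, _) => /=.
- by rewrite scalerDr tensDr linearD addrACA.
- by rewrite scalerDr tensDr linearD addrACA.
Qed.

Lemma quad_scaleDl q : {morph quad_scale^~ q : u v / u + v}.
Proof.
move=> u v; rewrite /quad_scale; congr (_, _) => /=.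
- by rewrite scalerDl tensDl linearD addrACA.
- by rewrite scalerDl tensDl linearD addrACA.
Qed.

HB.instance Definition _ := GRing.Zmodule_isLmodule.Build (morita N M) Q
  quad_scaleA quad_scale1 quad_scaleDr quad_scaleDl.

End QuadMod.

(* Main.v *)
Require Import Defs.
From HB Require Import structures.
From mathcomp Require Import all_boot all_algebra.
From mathcomp Require Import boolp.
From mathcomp Require Import freeg.

Set Implicit Arguments.
Unset Strict Implicit.
Unset Printing Implicit Defensive.

Import GRing.Theory.
Local Open Scope ring_scope.

(* A class C of modules consists of Gorenstein-projectives as soon as each G in
   C sits in exact sequences 0 -> G -> P -> G' -> 0 and 0 -> K -> P' -> G -> 0
   with P, P' finitely generated projective, G', K in C, and every map from K to
   a finitely generated projective extends to P': splicing gives the complete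
   resolution. Conversely the Gorenstein-projectives form such a class.

   Since M (x) N = 0 = N (x) M, the projective modules over the Morita ring are
   the quadruples (P + N (x) Q, Q + M (x) P) with P, Q projective. If (X, Y)_(f, g)
   is Gorenstein-projective, it embeds in a projective, hence is monic by flatness
   of M_A and N_B; the nine lemma turns exact sequences of monic quadruples into
   exact sequences of cokernels, and maps to (D, 0) with D projective extend
   because (D, 0) has a projective resolution of length one. So the cokernels of
   Gorenstein-projectives form a class as above. Conversely, for a monic quadruple
   with Gorenstein-projective cokernels U = Coker g and V = Coker f, a horseshoe
   construction combines U -> P -> U' and V -> Q -> V' (likewise the sequences
   on the other side) into an exact sequence of monic quadruples. *)

(** * Linear maps, short exact sequences, kernels and cokernels *)

Section LinearMaps.
Variable S : pzRingType.
Implicit Types V W U E K G H Q Z : lmodType S.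

Definition mklin V W (f : V -> W) (fL : linear f) : {linear V -> W} :=
  HB.pack f (GRing.isLinear.Build S V W *:%R f fL).

Definition surj V W (p : V -> W) := forall w, exists v, p v = w.

Definition exact V W U (i : V -> W) (p : W -> U) :=
  [/\ injective i, surj p & forall w, p w = 0 <-> exists v, i v = w].

Lemma linear_inj V W (i : {linear V -> W}) :
  (forall v, i v = 0 -> v = 0) -> injective i.
Proof.
move=> i0 x y /eqP; rewrite -subr_eq0 -linearB => /eqP/i0/eqP.
by rewrite subr_eq0 => /eqP.
Qed.

Lemma linear_inj0 V W (i : {linear V -> W}) v :
  injective i -> i v = 0 -> v = 0.
Proof. by move=> ii iv; apply: ii; rewrite iv linear0. Qed.

(** A choice of preimages under [p] composed with [h] works: by the kernel condition the result does
    not depend on the choice, hence is linear. *)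
Lemma factor_surj V W Z (p : {linear V -> W}) (h : {linear V -> Z}) :
  surj p -> (forall v, p v = 0 -> h v = 0) ->
  exists k : {linear W -> Z}, forall v, k (p v) = h v.
Proof.
move=> /choice[s sE] hp.
have hE u v : p u = p v -> h u = h v.
  by move/eqP; rewrite -subr_eq0 -linearB => /eqP/hp/eqP;
    rewrite linearB subr_eq0 => /eqP.
have L : linear (h \o s).
  by move=> a x y; rewrite /= -linearP; apply: hE; rewrite linearP !sE.
by exists (mklin L) => v; apply: hE; rewrite sE.
Qed.

Lemma factor_inj V W Z (i : {linear V -> W}) (h : {linear Z -> W}) :
  injective i -> (forall z, exists v, i v = h z) ->
  exists k : {linear Z -> V}, forall z, i (k z) = h z.
Proof.
move=> ii /choice[s sE].
have L : linear s by move=> a x y; apply: ii; rewrite linearP !sE linearP.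
by exists (mklin L) => v; apply: sE.
Qed.

Lemma linear_inv V W (j : {linear V -> W}) :
  injective j -> surj j ->
  exists k : {linear W -> V}, cancel j k /\ cancel k j.
Proof.
move=> ij sj.
have [|k kE] := @factor_inj _ _ _ j (idfun : {linear W -> W}) ij; first exact: sj.
by exists k; split=> // x; apply: ij; rewrite kE.
Qed.

Lemma bij_inj_surj V W (j : {linear V -> W}) :
  bijective j -> injective j /\ surj j.
Proof.
case=> k jk kj; split; first exact: can_inj jk.
by move=> w; exists (k w).
Qed.

Lemma inj_surj_bij V W (j : {linear V -> W}) :
  injective j -> surj j -> bijective j.
Proof. by move=> ij sj; have [k [jk kj]] := linear_inv ij sj; exists k. Qed.

Lemma exact_comp0 V W U (i : V -> W) (p : W -> U) v :
  exact i p -> p (i v) = 0.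
Proof. by case=> _ _ ex; apply/ex; exists v. Qed.

Lemma ker_val_linear V W (p : {linear V -> W}) : linear (@ker_val S V W p).
Proof. by []. Qed.

Definition ker_incl V W (p : {linear V -> W}) : {linear ker p -> V} :=
  mklin (@ker_val_linear V W p).

Lemma ker_incl_inj V W (p : {linear V -> W}) : injective (ker_incl p).
Proof. exact: val_inj. Qed.

Lemma ker_inclP V W (p : {linear V -> W}) v :
  p v = 0 <-> exists x, ker_incl p x = v.
Proof.
split=> [/eqP pv|[x <-]]; first by exists (Ker (pv : v \in ker_pred p)).
exact/eqP/(valP x).
Qed.

Lemma exact_ker V W (p : {linear V -> W}) :
  surj p -> exact (ker_incl p) p.
Proof. by move=> sp; split=> //; [apply: ker_incl_inj | apply: ker_inclP]. Qed.

Lemma coker_proj_linear V W (i : {linear V -> W}) : linear (coker_proj i).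
Proof. by move=> a x y; rewrite coker_projD -coker_scaleE. Qed.

Definition coker_linear V W (i : {linear V -> W}) : {linear W -> coker i} :=
  mklin (@coker_proj_linear V W i).

Lemma exact_coker_linear V W (i : {linear V -> W}) :
  injective i -> exact i (coker_linear i).
Proof.
move=> ii; split=> // [w|w].
  by exists (repr (w : Quotient.quot (im_pred i))); apply: coker_projK.
have -> : (coker_linear i w = 0) = (coker_linear i w = coker_linear i 0).
  by rewrite linear0.
by rewrite /= coker_projP subr0.
Qed.

Lemma exact_coker V W (i : {linear V -> W}) :
  injective i -> exists (U : lmodType S) (p : {linear W -> U}), exact i p.
Proof. by move=> ii; exists (coker i), (coker_linear i); apply: exact_coker_linear. Qed.

Lemma exact_iso_r V W U U' (i : {linear V -> W}) (p : {linear W -> U})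
    (j : {linear U -> U'}) :
  exact i p -> injective j -> surj j -> exact i (j \o p).
Proof.
move=> [ii sp ex] ij sj; split=> // [u|w].
  by have [u1 <-] := sj u; have [w <-] := sp u1; exists w.
rewrite -ex; split=> [/= h|/= ->]; last by rewrite linear0.
exact: linear_inj0 h.
Qed.

Lemma exact_iso_l (V V' W U : lmodType S)
    (i : {linear V -> W}) (p : {linear W -> U}) (k : {linear V' -> V}) :
  exact i p -> injective k -> surj k -> exact (i \o k) p.
Proof.
move=> [ii sp ex] ik sk; split=> // [x y /ii/ik //|w].
rewrite ex; split=> [[v <-]|[v <-]]; last by exists (k v).
by have [v' <-] := sk v; exists v'.
Qed.

Lemma exact_iso_m (V W W' U : lmodType S)
    (i : {linear V -> W}) (p : {linear W -> U}) (k : {linear W -> W'})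
    (l : {linear W' -> W}) :
  exact i p -> cancel k l -> cancel l k -> exact (k \o i) (p \o l).
Proof.
move=> [ii sp ex] kl lk; split=> [x y /= /(can_inj kl)/ii //|u|w].
  by have [w <-] := sp u; exists (k w); rewrite /= kl.
rewrite /= ex; split=> [[v vE]|[v <-]]; first by exists v; rewrite vE lk.
by exists v; rewrite kl.
Qed.

(** * The nine lemma *)

Section Nine.
Variables T1 T2 T3 X1 X2 X3 U1 U2 U3 : lmodType S.
Variables (t12 : {linear T1 -> T2}) (t23 : {linear T2 -> T3}).
Variables (x12 : {linear X1 -> X2}) (x23 : {linear X2 -> X3}).
Variables (u12 : {linear U1 -> U2}) (u23 : {linear U2 -> U3}).
Variables (g1 : {linear T1 -> X1}) (g2 : {linear T2 -> X2}).
Variables (g3 : {linear T3 -> X3}).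
Variables (q1 : {linear X1 -> U1}) (q2 : {linear X2 -> U2}).
Variables (q3 : {linear X3 -> U3}).
Hypothesis gg12 : forall t, g2 (t12 t) = x12 (g1 t).
Hypothesis gg23 : forall t, g3 (t23 t) = x23 (g2 t).
Hypothesis qq12 : forall x, q2 (x12 x) = u12 (q1 x).
Hypothesis qq23 : forall x, q3 (x23 x) = u23 (q2 x).
Hypotheses (exT : exact t12 t23) (exX : exact x12 x23).

(** The rows are the sequences in T, X and U, the columns the pairs [g], [q]; exactness passes from
    the first two columns to the third by a diagram chase. *)
Lemma nine_bot : exact u12 u23 -> exact g1 q1 -> exact g2 q2 -> exact g3 q3.
Proof.
case: exT exX => it st et [ix sx ex] [iu su eu] [i1 s1 e1] [i2 s2 e2].
split.
- apply: linear_inj => t; have [t2 <-] := st t; rewrite gg23 => /ex[y yE].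
  have /e1[t1 t1E] : q1 y = 0.
    by apply: (linear_inj0 iu); rewrite -qq12 yE; apply/e2; exists t2.
  by apply/et; exists t1; apply: i2; rewrite gg12 t1E.
- by move=> u; have [u2 <-] := su u; have [x2 <-] := s2 u2;
    exists (x23 x2); rewrite qq23.
- move=> w; split=> [|[t <-]].
    have [x <-] := sx w; rewrite qq23 => /eu[u uE].
    have [x1 x1E] := s1 u.
    have /e2[t tE] : q2 (x - x12 x1) = 0 by rewrite linearB qq12 x1E uE subrr.
    exists (t23 t); rewrite gg23 tE linearB.
    by have /ex -> : exists v, x12 v = x12 x1; rewrite ?subr0 //; exists x1.
  have [t2 <-] := st t; rewrite gg23 qq23.
  by have /e2 -> : exists v, g2 v = g2 t2; rewrite ?linear0 //; exists t2.
Qed.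

Lemma nine_top : exact u12 u23 -> exact g2 q2 -> exact g3 q3 -> exact g1 q1.
Proof.
case: exT exX => it st et [ix sx ex] [iu su eu] [i2 s2 e2] [i3 s3 e3].
split.
- apply: linear_inj => t h; apply: (linear_inj0 it); apply: (linear_inj0 i2).
  by rewrite gg12 h linear0.
- move=> u; have [x xE] := s2 (u12 u).
  have /e3[t tE] : q3 (x23 x) = 0 by rewrite qq23 xE; apply/eu; exists u.
  have [t2 t2E] := st t.
  have /ex[x1 x1E] : x23 (x - g2 t2) = 0.
    by rewrite linearB -gg23 t2E tE subrr.
  exists x1; apply: iu; rewrite -qq12 x1E linearB xE.
  by have /e2 -> : exists v, g2 v = g2 t2; rewrite ?subr0 //; exists t2.
- move=> x; split=> [h|[t <-]].
    have /e2[t2 t2E] : q2 (x12 x) = 0 by rewrite qq12 h linear0.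
    have /et[t1 t1E] : t23 t2 = 0.
      by apply: (linear_inj0 i3); rewrite gg23 t2E; apply/ex; exists x.
    by exists t1; apply: ix; rewrite -gg12 t1E.
  apply: (linear_inj0 iu); rewrite -qq12 -gg12; apply/e2.
  by exists (t12 t).
Qed.

End Nine.

(** The maps between the U's come from factoring through the cokernels; their exactness is
    [nine_bot] for the transposed diagram. *)
Lemma nine_right (T1 T2 T3 X1 X2 X3 U1 U2 U3 : lmodType S)
    (t12 : {linear T1 -> T2}) (t23 : {linear T2 -> T3})
    (x12 : {linear X1 -> X2}) (x23 : {linear X2 -> X3})
    (g1 : {linear T1 -> X1}) (g2 : {linear T2 -> X2}) (g3 : {linear T3 -> X3})
    (q1 : {linear X1 -> U1}) (q2 : {linear X2 -> U2}) (q3 : {linear X3 -> U3}) :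
  (forall t, g2 (t12 t) = x12 (g1 t)) -> (forall t, g3 (t23 t) = x23 (g2 t)) ->
  exact t12 t23 -> exact x12 x23 ->
  exact g1 q1 -> exact g2 q2 -> exact g3 q3 ->
  exists (u12 : {linear U1 -> U2}) (u23 : {linear U2 -> U3}),
    [/\ forall x, q2 (x12 x) = u12 (q1 x), forall x, q3 (x23 x) = u23 (q2 x) &
        exact u12 u23].
Proof.
move=> gg12 gg23 exT exX ex1 ex2 ex3.
have [_ s1 e1] := ex1; have [_ s2 e2] := ex2.
have [|u12 u12E] := factor_surj (h := q2 \o x12) s1.
  by move=> x /e1[t <-]; rewrite /= -gg12 (exact_comp0 _ ex2).
have [|u23 u23E] := factor_surj (h := q3 \o x23) s2.
  by move=> x /e2[t <-]; rewrite /= -gg23 (exact_comp0 _ ex3).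
exists u12, u23; split=> //.
by apply: (nine_bot (t12 := g1) (t23 := q1) (x12 := g2) (x23 := q2) (u12 := g3)
  (u23 := q3) (g1 := t12) (g2 := x12) (q1 := t23) (q2 := x23)) => // x.
Qed.

(** * Projective modules and extensions *)

Definition fgproj V := fg V /\ projective V.

Lemma fg_surj V W (p : {linear V -> W}) : surj p -> fg V -> fg W.
Proof.
move=> sp [n [e eE]]; exists n, (p \o e) => w.
have [v <-] := sp w; have [c ->] := eE v; exists c.
by rewrite linear_sum; apply: eq_bigr => i _; rewrite linearZ_LR.
Qed.

Lemma projective_retract V W (i : {linear V -> W}) (p : {linear W -> V}) :
  cancel i p -> projective W -> projective V.
Proof.
move=> ip pW X Y q h sq; have [k kE] := pW _ _ q (h \o p) sq.
by exists (k \o i) => x; rewrite /= kE /= ip.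
Qed.

Lemma fgproj_iso V W (j : {linear V -> W}) :
  injective j -> surj j -> fgproj V -> fgproj W.
Proof.
move=> ij sj [fV pV]; split; first exact: fg_surj sj fV.
by have [k [jk kj]] := linear_inv ij sj; apply: projective_retract kj pV.
Qed.

(** This turns finite generation into an induction principle over linear combinations, so that later
    proofs handle no coefficient families. *)
Lemma fg_span V : fg V <->
  exists s : seq V, forall P : V -> Prop, P 0 ->
    (forall a x y, P x -> P y -> P (a *: x + y)) ->
    (forall x, x \in s -> P x) -> forall v, P v.
Proof.
split=> [[n [e eE]]|[s sE]].
  exists [seq e i | i <- enum 'I_n] => P P0 PD Ps v.
  have [c ->] := eE v; elim/big_rec: _ => // i x _ Px.
  by apply: PD => //; apply/Ps/map_f; rewrite mem_enum.
exists (size s), (fun i => s`_i).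
apply: sE => [|a x y [c ->] [d ->]|x xs].
- by exists (fun=> 0); rewrite big1 // => i _; rewrite scale0r.
- exists (fun i => a * c i + d i); rewrite scaler_sumr -big_split.
  by apply: eq_bigr => i _; rewrite scalerDl scalerA.
- have hi : (index x s < size s)%N by rewrite index_mem.
  exists (fun i => if i == Ordinal hi then 1 else 0).
  rewrite (bigD1 (Ordinal hi)) //= eqxx scale1r nth_index // big1 ?addr0 //.
  by move=> i /negPf->; rewrite scale0r.
Qed.

(** A finite generating family gives a surjection from a free module onto [V]; projectivity splits
    it, and the coordinates of the section are the [s i]. *)
Lemma dual_basis V : fgproj V ->
  exists (n : nat) (e : 'I_n -> V) (s : 'I_n -> {linear V -> S^o}),
    forall v, v = \sum_(i < n) (s i v : S) *: e i.
Proof.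
move=> [[n [e eE]] pV].
pose p (c : {ffun 'I_n -> S^o}) := \sum_(i < n) (c i : S) *: e i.
have pL : linear p.
  move=> a x y; rewrite /p scaler_sumr -big_split; apply: eq_bigr => i _ /=.
  by rewrite !ffunE scalerDl scalerA.
have [w|k kE] := pV _ _ (mklin pL) (idfun : {linear V -> V}).
  have [c ->] := eE w; exists [ffun i => c i].
  by apply: eq_bigr => i _; rewrite ffunE.
have sL i : linear (fun v => k v i : S^o).
  by move=> a x y; rewrite linearP !ffunE.
by exists n, e, (fun i => mklin (sL i)) => v; rewrite -[LHS](kE v).
Qed.

Definition extends K E (i : K -> E) Q :=
  forall h : {linear K -> Q}, exists k : {linear E -> Q}, forall x, k (i x) = h x.

Lemma extends_iso (K P Q Q' : lmodType S) (i : {linear K -> P})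
    (j : {linear Q -> Q'}) :
  injective j -> surj j -> extends i Q -> extends i Q'.
Proof.
move=> ij sj e h; have [l [jl lj]] := linear_inv ij sj.
have [k kE] := e (l \o h); exists (j \o k) => x.
by rewrite /= kE /= lj.
Qed.

(** This is the vanishing of Ext^1(G, Q), phrased through extension of maps. *)
Definition ext0 G Q := forall K E (i : {linear K -> E}) (p : {linear E -> G}),
  exact i p -> extends i Q.

(** One projective presentation decides the vanishing of Ext^1. Lifting [E -> G] to [l : E -> E']
    induces [m : K -> K'] and makes [E'] the pushout of [K'] and [E] along [K]; thus [h] and an
    extension [u] of [h \o m] glue to a map on [E']. *)
Lemma ext0_presented K E G Q (i : {linear K -> E}) (p : {linear E -> G}) :
  projective E -> exact i p -> extends i Q -> ext0 G Q.
Proof.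
move=> pE [ii sp ex] exQ K' E' i' p' [ii' sp' ex'] h.
have [l lE] := pE _ _ p' p sp'.
have [x|m mE] := @factor_inj _ _ _ i' (l \o i) ii'.
  by apply/ex'; rewrite /= lE; apply/ex; exists x.
have [u uE] := exQ (h \o m).
pose c (z : K' * E) := i' z.1 + l z.2.
pose d (z : K' * E) := h z.1 + u z.2.
have cL : linear c.
  move=> a x y; rewrite /c /= !linearP scalerDr.
  by rewrite addrACA.
have dL : linear d by move=> a x y; rewrite /d /= !linearP scalerDr addrACA.
have [||k kE] := @factor_surj _ _ _ (mklin cL) (mklin dL).
- move=> e; have [x xE] := sp (p' e).
  have /ex'[y yE] : p' (e - l x) = 0 by rewrite linearB lE xE subrr.
  by exists (y, x); rewrite /= /c /= yE subrK.
(* The kernel of [c] consists of the pairs [(- m z, i z)], and [d] vanishes on them because [u]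
   extends [h \o m]. *)
- move=> [y x]; rewrite /= /c /d /= => yx.
  have /ex[z zE] : p x = 0.
    rewrite -lE -[l x](addKr (i' y)) yx addr0 linearN.
    by have /ex' -> : exists v, i' v = i' y; rewrite ?oppr0 //; exists y.
  suff -> : y = - m z by rewrite linearN -zE uE addNr.
  by apply: ii'; rewrite linearN mE /= zE -[LHS](addrK (l x)) yx sub0r.
- exists k => x; have := kE (x, 0).
  by rewrite /= /c /d /= !linear0 !addr0.
Qed.

(** * Gorenstein-projective modules as a coinductive class *)

Definition has_next (C : lmodType S -> Prop) G :=
  exists (P G' : lmodType S) (i : {linear G -> P}) (p : {linear P -> G'}),
    [/\ fgproj P, exact i p & C G'].

Definition has_prev (C : lmodType S -> Prop) G :=
  exists (K P : lmodType S) (i : {linear K -> P}) (p : {linear P -> G}),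
    [/\ fgproj P, exact i p, C K & forall Q, fgproj Q -> extends i Q].

Definition gp_class C := forall G, C G -> has_next C G /\ has_prev C G.

(** One link of a complete resolution: [mid] becomes a term, and [ses_out] followed by the [ses_in]
    of the next link becomes a differential. *)
Record ses G G' := Ses {
  mid : lmodType S;
  ses_in : {linear G -> mid};
  ses_out : {linear mid -> G'};
  mid_fgproj : fgproj mid;
  ses_exact : exact ses_in ses_out;
  ses_ext : forall Q, fgproj Q -> extends ses_in Q
}.

Lemma gp_intro C G : gp_class C -> C G -> gorenstein_projective G.
Proof.
move=> gC CG.
(* Each [H] in [C] has Ext^1(H, Q) = 0, since [has_prev] presents it. This gives the extension
   property of the sequences continuing to the right, whose cokernels lie in [C]. *)
have ext H Q : C H -> fgproj Q -> ext0 H Q.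
  move=> CH pQ; have [_ [K [P [i [p [[fP pP] ex _ h]]]]]] := gC _ CH.
  by apply: (ext0_presented pP ex); apply: h.
pose T := {H : lmodType S | C H}.
have nextP (H : T) : exists H' : T, inhabited (ses (sval H) (sval H')).
  case: H => H CH; have [[P [G' [i [p [hP ex CG']]]]] _] := gC _ CH.
  by exists (exist _ G' CG'); constructor; exists P i p => // Q hQ; apply: ext ex.
have prevP (H : T) : exists H' : T, inhabited (ses (sval H') (sval H)).
  case: H => H CH; have [_ [K [P [i [p [hP ex CK h]]]]]] := gC _ CH.
  by exists (exist _ K CK); constructor; exists P i p.
have [nx nxP] := choice nextP; have [pv pvP] := choice prevP.
pose Z0 : T := exist _ G CG.
(* The cycles of the resolution, with [Z 0] the given module. As [Negz n] is -(n+1), it takes n+1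
   backward steps. *)
pose Z (i : int) : T :=
  match i with Posz n => iter n nx Z0 | Negz n => iter n.+1 pv Z0 end.
have ZP i : inhabited (ses (sval (Z i)) (sval (Z (i + 1)))).
  case: i => [n|[|n]].
  - have -> : Posz n + 1 = Posz n.+1 by rewrite intS addrC.
    exact: nxP.
  - exact: pvP.
  - have -> : Negz n.+1 + 1 = Negz n.
      by rewrite !NegzE (intS n.+1) opprD addrAC addNr add0r.
    exact: pvP.
pose s i := inhabited_witness (ZP i).
exists (fun i => mid (s i)), (fun i => ses_in (s (i + 1)) \o ses_out (s i)).
split.
- by move=> i; apply: mid_fgproj.
- move=> i x; case: (ses_exact (s (i + 1))) => _ _ ex.
  case: (ses_exact (s i)) => _ sp _.
  case: (ses_exact (s (i + 1 + 1))) => ii _ _.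
  split=> [/= h|[y <-] /=].
    have /ex[z <-] := linear_inj0 ii h.
    by have [y <-] := sp z; exists y.
  by rewrite (exact_comp0 _ (ses_exact _)) linear0.
(* A map that kills the image of the differential factors through [ses_out], that is, through the
   next cycle module, and from there extends to the next term. *)
- move=> Q fQ pQ i h; split=> [h0|[k kE] x]; last first.
    by rewrite -kE /= (exact_comp0 _ (ses_exact _)) !linear0.
  case: (ses_exact (s (i + 1))) => _ sp ex.
  have [|h' h'E] := @factor_surj _ _ _ (ses_out (s (i + 1))) h sp.
    move=> v /ex[z <-]; case: (ses_exact (s i)) => _ sp' _.
    by have [y <-] := sp' z; apply: h0.
  have [k kE] := ses_ext (s (i + 1 + 1)) (conj fQ pQ) h'.
  by exists k => x; rewrite /= kE h'E.
(* The kernel of the differential at 0 is the image of [ses_in (s 0)], a copy of [G]. *)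
- case: (ses_exact (s 0)) => ii _ ex.
  case: (ses_exact (s (0 + 1))) => ii1 _ _.
  set d0 := ses_in (s (0 + 1)) \o ses_out (s 0).
  have dE x : d0 x = 0 <-> exists y, ses_in (s 0) y = x.
    rewrite -ex; split=> [/(linear_inj0 ii1)//|h].
    by rewrite /d0 /= h linear0.
  have [y|j jE] := factor_inj (h := ses_in (s 0)) (@ker_incl_inj _ _ d0).
    by apply/ker_inclP/dE; exists y.
  exists j; apply: inj_surj_bij => [x y|z].
    by move/(congr1 (ker_incl d0)); rewrite !jE => /ii.
  have /dE[y yE] : d0 (ker_incl d0 z) = 0 by apply/ker_inclP; exists z.
  by exists y; apply: (@ker_incl_inj _ _ d0); rewrite jE.
Qed.

(** The class consists of the modules isomorphic to some cycle module [ker (d i)]; the neighbouring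
    cycles give both short exact sequences. *)
Lemma gp_elim G :
  gorenstein_projective G -> exists C, gp_class C /\ C G.
Proof.
move=> [P [d [hP ac hac [j bj]]]].
have subr1K (i : int) : exists k : int, i = k + 1 by exists (i - 1); rewrite subrK.
have /all_sig[c cE] i : {c : {linear P i -> ker (d (i + 1))} |
    forall x, ker_incl (d (i + 1)) (c x) = d i x}.
  apply: cid; apply: factor_inj => [|x]; first exact: ker_incl_inj.
  by apply/ker_inclP/ac; exists x.
have ex i : exact (ker_incl (d i)) (c i).
  split=> [||w]; first exact: ker_incl_inj.
    move=> w; have /ac[y yE] : d (i + 1) (ker_incl (d (i + 1)) w) = 0.
      by apply/ker_inclP; exists w.
    by exists y; apply: (@ker_incl_inj _ _ (d (i + 1))); rewrite cE.
  rewrite -ker_inclP -cE; split=> [->|]; first by rewrite linear0.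
  by apply: linear_inj0; apply: ker_incl_inj.
exists (fun H => exists i (h : {linear H -> ker (d i)}), bijective h).
split; last by exists 0, j.
move=> H [i [h /bij_inj_surj[ih sh]]].
have [h' [hh' h'h]] := linear_inv ih sh.
split.
  exists (P i), (ker (d (i + 1))), (ker_incl (d i) \o h), (c i).
  split; first exact: hP.
    have [iv sc ev] := ex i; split=> [x y /iv/ih//|//|w].
    rewrite ev; split=> [[x <-]|[x <-]]; last by exists (h x).
    by exists (h' x); rewrite /= h'h.
  by exists (i + 1), idfun; exists idfun.
(* Writing the index as m + 1 + 1 + 1 lets the terms and differentials of the preceding degrees
   typecheck without casts. *)
have [k kE] := subr1K i; have [l lE] := subr1K k; have [m mE] := subr1K l.
subst i k l; set k := m + 1 in h h' ih sh hh' h'h *.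
exists (ker (d (k + 1))), (P (k + 1)), (ker_incl (d _)), (h' \o c _).
have [ih' sh'] : injective h' /\ surj h'.
  by apply: bij_inj_surj; exists h.
split; first exact: hP.
- by apply: exact_iso_r sh'; [apply: ex|].
- by exists (k + 1), idfun; exists idfun.
move=> Q [fQ pQ] u.
(* A map [u] on the cycles, pulled back to the term before them, kills boundaries; acyclicity of the
   Hom complex extends it to the next term. *)
have [+ _] := hac Q fQ pQ m (u \o c k).
case=> [x|t tE].
  have [_ _ ev] := ex k; rewrite -cE.
  have /ev /= -> : exists v, ker_incl (d k) v = ker_incl (d (m + 1)) (c m x).
    by exists (c m x).
  by rewrite linear0.
exists t => x; have [_ sc _] := ex k; have [y <-] := sc x.
by rewrite cE tE.
Qed.

Lemma gp_unfold : gp_class (@gorenstein_projective S).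
Proof.
move=> G /gp_elim[C [gC CG]].
have [[P [G' [i [p [hP ex CG']]]]] [K [P' [i' [p' [hP' ex' CK e]]]]]] := gC _ CG.
split; first by exists P, G', i, p; split=> //; apply: gp_intro CG'.
by exists K, P', i', p'; split=> //; apply: gp_intro CK.
Qed.

Lemma gp_ext0 G Q : gorenstein_projective G -> fgproj Q -> ext0 G Q.
Proof.
move=> /gp_unfold[_ [K [P [i [p [[_ pP] ex _ h]]]]]] pQ.
by apply: (ext0_presented pP ex); apply: h.
Qed.

Lemma gp_iso G H (j : {linear G -> H}) :
  injective j -> surj j -> gorenstein_projective H -> gorenstein_projective G.
Proof.
move=> ij sj [P [d [hP ac hac [l bl]]]]; exists P, d; split=> //.
by exists (l \o j); apply: bij_comp => //; apply: inj_surj_bij.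
Qed.

(** Ext^1(G, Q1) = 0 at work: [h] lifts on a projective presentation of [G], the lift restricts to a
    map [m : K -> Q1], and subtracting an extension of [m] lets it descend to [G]. *)
Lemma gp_lift G Q1 Q2 Q3 (i : {linear Q1 -> Q2}) (p : {linear Q2 -> Q3})
    (h : {linear G -> Q3}) :
  gorenstein_projective G -> fgproj Q1 -> exact i p ->
  exists k : {linear G -> Q2}, forall x, p (k x) = h x.
Proof.
move=> gG fQ1 [ii sp ex].
have [_ [K [P [a [b [[_ pP] [ia sb exab] _ e]]]]]] := gp_unfold gG.
have [l lE] := pP _ _ p (h \o b) sp.
have [x|m mE] := @factor_inj _ _ _ i (l \o a) ii.
  apply/ex; rewrite /= lE /=.
  by have /exab -> : exists v, a v = a x; rewrite ?linear0 //; exists x.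
have [n nE] := e _ fQ1 m.
have [x|k kE] := @factor_surj _ _ _ b (l \- (i \o n)) sb.
  by move=> /exab[y <-] /=; rewrite nE mE subrr.
exists k => x; have [y <-] := sb x; rewrite kE /= linearB lE /=.
by have /ex -> : exists v, i v = i (n y); rewrite ?subr0 //; exists (n y).
Qed.

(* Q3 has a resolution of length one by projectives, and every map into it from
   a Gorenstein-projective module lifts to Q2; hence it also extends. *)
Lemma gp_ext0_pd1 G Q1 Q2 Q3 (i : {linear Q1 -> Q2}) (p : {linear Q2 -> Q3}) :
  gorenstein_projective G -> fgproj Q1 -> fgproj Q2 -> exact i p -> ext0 G Q3.
Proof.
move=> gG fQ1 fQ2 ex.
have [_ [K [P [a [b [[_ pP] exab gK e]]]]]] := gp_unfold gG.
apply: (ext0_presented pP exab) => h.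
have [l lE] := gp_lift h gK fQ1 ex; have [k kE] := e _ fQ2 l.
by exists (p \o k) => x; rewrite /= kE.
Qed.

End LinearMaps.

(** * Tensor products *)

Section TensorFunctor.
Variables (R : comNzRingType) (B A : algType R) (M : bimodType B A).
Implicit Types (X : lmodType A) (Y : lmodType B).

(** Sums and pure tensors suffice: negative integer coefficients are absorbed by [tens (- m) x]. *)
Lemma tens_ind X (P : tensor M X -> Prop) :
  (forall t u, P t -> P u -> P (t + u)) ->
  (forall m x, P (tens m x)) -> forall t, P t.
Proof.
move=> PD Pt t; rewrite -(tensor_projK t).
have t0 (x : X) : tens (0 : M) x = 0.
  by apply: (addrI (tens 0 x)); rewrite -tensDl !addr0.
have P0 : P 0 by rewrite -(t0 0).
have PMn m x n : P (tens m x *+ n).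
  by elim: n => [|n IH]; rewrite ?mulr0n // mulrS; apply: PD.
elim/freeg_ind_dom0: (repr _) => [|k z D _ _ IH]; first by rewrite raddf0.
rewrite raddfD; apply: PD => //.
have -> : << k *g z >> = << z >> *~ k :> {freeg (M * X)%type}.
  by rewrite freegU_mulz intz.
rewrite raddfMz; case: z => m x.
case: k => n; first exact: PMn.
rewrite NegzE mulrNz -mulNrn.
suff -> : - tensor_proj << (m, x) >> = tens (- m) x by apply: PMn.
by apply/eqP; rewrite eq_sym -addr_eq0 -[X in _ + X]/(tens m x) -tensDl addNr t0.
Qed.

Lemma tensor_lift_linear X Y (beta : M -> X -> Y) :
  (forall m m' x, beta (m + m') x = beta m x + beta m' x) ->
  (forall m x x', beta m (x + x') = beta m x + beta m x') ->
  (forall m a x, beta (ract m a) x = beta m (a *: x)) ->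
  (forall b m x, beta (b *: m) x = b *: beta m x) ->
  exists h : {linear tensor M X -> Y}, forall m x, h (tens m x) = beta m x.
Proof.
move=> bDl bDr bm bZ; have [h hE] := tensor_lift bDl bDr bm.
have hZ b t : h (b *: t) = b *: h t.
  elim/tens_ind: t => [t t' IH IH'|m x].
    by rewrite scalerDr !raddfD IH IH'.
  have -> : b *: tens m x = tens (b *: m) x by rewrite tensZl.
  by rewrite !hE bZ.
have hL : linear h by move=> b t u; rewrite raddfD; congr (_ + _).
by exists (mklin hL).
Qed.

Lemma tmap_subproof X X' (h : {linear X -> X'}) :
  exists k : {linear tensor M X -> tensor M X'},
    forall m x, k (tens m x) = tens m (h x).
Proof.
apply: tensor_lift_linear => *.
- exact: tensDl.
- by rewrite linearD tensDr.
- by rewrite tens_mid linearZ_LR.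
- exact: tensZl.
Qed.

Definition tmap X X' (h : {linear X -> X'}) := sval (cid (tmap_subproof h)).

Lemma tmapE X X' (h : {linear X -> X'}) m x : tmap h (tens m x) = tens m (h x).
Proof. exact: (svalP (cid (tmap_subproof h))). Qed.

(** The composite enters as any [l] that agrees with it pointwise, so that no equality of linear
    maps is required. *)
Lemma tmap_comp X X' X'' (h : {linear X -> X'}) (k : {linear X' -> X''})
    (l : {linear X -> X''}) t :
  (forall x, k (h x) = l x) -> tmap k (tmap h t) = tmap l t.
Proof.
move=> klE; apply: (tensor_ext (g := tmap k \o tmap h)) => m x /=.
by rewrite !tmapE klE.
Qed.

Lemma tmap_id X t : tmap (idfun : {linear X -> X}) t = t.
Proof. by apply: (tensor_ext (h := idfun)) => m x /=; rewrite tmapE. Qed.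

Lemma tmap_surj X X' (h : {linear X -> X'}) : surj h -> surj (tmap h).
Proof.
move=> sh t; elim/tens_ind: t => [_ _ [t <-] [t' <-]|m x].
  by exists (t + t'); rewrite linearD.
by have [y <-] := sh x; exists (tens m y); rewrite tmapE.
Qed.

(* If the e_i generate M_A and the s_i : M -> A form the dual basis, an element t
   of M (x) X is the sum of the e_i (x) c_i(t), where c_i = s_i (x) X. *)
Lemma tensor_coord (hM : fgproj (right_mod M)) :
  exists (n : nat) (e : 'I_n -> M)
    (c : 'I_n -> forall X, {additive tensor M X -> X}),
  (forall X (t : tensor M X), t = \sum_(i < n) tens (e i) (c i X t)) /\
  (forall i X X' (h : {linear X -> X'}) t, c i X' (tmap h t) = h (c i X t)).
Proof.
have [n [e [s sE]]] := dual_basis hM.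
have ex i X : exists c : {additive tensor M X -> X},
    forall m x, c (tens m x) = (s i m : A) *: x.
  apply: tensor_lift => [m m' x|m x x'|m a x].
  - by rewrite linearD scalerDl.
  - by rewrite scalerDr.
  - have -> : s i (ract m a) = (s i m : A) * a :> A.
      by rewrite -[ract m a]/((a : A^c) *: (m : right_mod M)) linearZ_LR.
    by rewrite scalerA.
pose c i X := sval (cid (ex i X)).
have cE i X m x : c i X (tens m x) = (s i m : A) *: x.
  exact: (svalP (cid (ex i X))).
exists n, e, c; split=> [X|i X X' h] t.
  pose F (t : tensor M X) := \sum_(i < n) tens (e i) (c i X t).
  have FB : zmod_morphism F.
    move=> u v; rewrite /F -sumrB; apply: eq_bigr => i _.
    apply/eqP; rewrite eq_sym subr_eq -tensDr -raddfD subrK; exact: eqxx.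
  pose Fa : {additive tensor M X -> tensor M X} :=
    HB.pack F (GRing.isZmodMorphism.Build _ _ F FB).
  apply: (tensor_ext (g := idfun) (h := Fa)) => m x; rewrite /= /F.
  rewrite [in LHS](sE m : m = \sum_(i < n) ract (e i) (s i m)).
  have -> : tens (\sum_(i < n) ract (e i) (s i m : A)) x =
      \sum_(i < n) tens (ract (e i) (s i m : A)) x.
    apply: (big_morph (fun m => tens m x)) => [m1 m2|]; first exact: tensDl.
    exact: tens0l.
  by apply: eq_bigr => i _; rewrite cE tens_mid.
by apply: (tensor_ext (g := c i X' \o tmap h) (h := h \o c i X)) => m x /=;
  rewrite tmapE !cE linearZ_LR.
Qed.

(** Flatness of M_A by coordinates: the [c i] are natural in the module, so vanishing and preimages
    can be tested coordinate by coordinate. *)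
Lemma tensor_exact (hM : fgproj (right_mod M)) X1 X2 X3
    (i : {linear X1 -> X2}) (p : {linear X2 -> X3}) :
  exact i p -> exact (tmap i) (tmap p).
Proof.
move=> [ii sp ex]; have [n [e [c [cE cn]]]] := tensor_coord hM; split.
- apply: linear_inj => t t0; rewrite (cE _ t) big1 // => k _.
  have -> : c k X1 t = 0 by apply: (linear_inj0 ii); rewrite -cn t0 raddf0.
  by apply: (addrI (tens (e k) 0)); rewrite -tensDr !addr0.
- exact: tmap_surj.
- move=> t; split=> [t0|[u <-]].
    have /choice[x xE] k : exists x, i x = c k X2 t.
      by apply/ex; rewrite -cn t0 raddf0.
    exists (\sum_(k < n) tens (e k) (x k)); rewrite linear_sum [RHS]cE.
    by apply: eq_bigr => k _; rewrite tmapE xE.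
  rewrite (tmap_comp (l := \0)); last first.
    by move=> x; rewrite /=; apply/ex; exists x.
  apply: (tensor_ext (g := tmap \0) (h := \0)) => m x /=; rewrite tmapE.
  by apply: (addrI (tens m 0)); rewrite -tensDr !addr0.
Qed.

(** Pure tensors of generators generate. For lifting, take a dual basis [e], [s] of [X], lift each
    [m |-> h (tens m (e i))] by projectivity of [M] to [k i], and sum the [k i (ract m (s i x))]. *)
Lemma fgproj_tensor (hM : fgproj M) X : fgproj X -> fgproj (tensor M X).
Proof.
move=> hX; split.
  have [/fg_span[s sE] _] := hM; have [/fg_span[r rE] _] := hX.
  apply/fg_span; exists [seq tens m x | m <- s, x <- r] => P P0 PD Ps.
  have PDD (t u : tensor M X) : P t -> P u -> P (t + u).
    by move=> Pt Pu; rewrite -[t]scale1r; apply: PD.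
  have PZ (b : B) (t : tensor M X) : P t -> P (b *: t).
    by move=> Pt; rewrite -[b *: t]addr0; apply: PD.
  have t0 (m : M) : tens m (0 : X) = 0.
    by apply: (addrI (tens m 0)); rewrite -tensDr !addr0.
  apply: tens_ind => // m x; move: x m; apply: rE.
  - by move=> m; rewrite t0.
  - move=> a x y Px Py m; rewrite tensDr -tens_mid; exact: PDD.
  move=> x xr; apply: sE.
  - by rewrite tens0l.
  - by move=> b m m' Pm Pm'; rewrite tensDl tensZl; apply: PDD => //; apply: PZ.
  - by move=> m ms; apply/Ps/allpairs_f.
have [n [e [s sE]]] := dual_basis hX.
move=> V W p h sp; have [_ pM] := hM.
have hiL i : linear (fun m => h (tens m (e i))).
  by move=> b m m'; rewrite tensDl tensZl linearP.
have /choice[k kE] i : exists k : {linear M -> V}, forall m, p (k m) = h (tens m (e i)).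
  by have [k kE] := pM _ _ p (mklin (hiL i)) sp; exists k.
pose beta m x := \sum_(i < n) k i (ract m (s i x : A)).
have [|||| l lE] := @tensor_lift_linear X V beta.
- move=> m m' x; rewrite /beta -big_split; apply: eq_bigr => i _ /=.
  by rewrite ractDl linearD.
- move=> m x x'; rewrite /beta -big_split; apply: eq_bigr => i _ /=.
  by rewrite linearD ractDr linearD.
- move=> m a x; rewrite /beta; apply: eq_bigr => i _.
  by rewrite ractA linearZ_LR.
- move=> b m x; rewrite /beta scaler_sumr; apply: eq_bigr => i _.
  by rewrite -scale_ract linearZ_LR.
exists l; apply: (tensor_ext (g := p \o l)) => m x /=.
rewrite lE /beta linear_sum [in RHS](sE x).
have -> : tens m (\sum_(i < n) (s i x : A) *: e i) =
    \sum_(i < n) tens m ((s i x : A) *: e i).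
  apply: (big_morph (tens m)) => [x1 x2|]; first exact: tensDr.
  by apply: (addrI (tens m 0)); rewrite -tensDr !addr0.
rewrite linear_sum; apply: eq_bigr => i _.
by rewrite kE tens_mid.
Qed.

End TensorFunctor.

Lemma fgproj_bimod (R : comNzRingType) (B A : algType R) (M : bimodType B A) :
  fg (base_mod M) -> projective M -> fgproj M.
Proof.
move=> [n [e eE]] pM; split=> //; exists n, e => m.
by have [c cE] := eE m; exists (fun i => (c i)%:A).
Qed.

Lemma fgproj_right_mod (R : comNzRingType) (B A : algType R) (M : bimodType B A) :
  fg (base_mod M) -> projective (right_mod M) -> fgproj (right_mod M).
Proof.
move=> [n [e eE]] pM; split=> //; exists n, e => m.
have [c cE] := eE m; exists (fun i => (c i)%:A : A); rewrite [LHS]cE.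
by apply: eq_bigr => i _; apply: ract_central.
Qed.

(** For fixed [y] the pure tensor [tens m (tens n y)] is balanced in [m] and [n], so it factors
    through the zero module M (x) N; this stands in for associativity. *)
Lemma tensor_tensor0 (R : comNzRingType) (A B : algType R)
    (N : bimodType A B) (M : bimodType B A) (Y : lmodType B) :
  zero_module (tensor M N) -> zero_module (tensor M (tensor N Y)).
Proof.
move=> MN0; have H m n (y : Y) : tens m (tens n y) = 0 :> tensor M (tensor N Y).
  have [|||h hE] := @tensor_lift _ _ _ M N _ (fun (m : M) (n : N) => tens m (tens n y)).
  - by move=> *; rewrite tensDl.
  - by move=> *; rewrite tensDl tensDr.
  - by move=> *; rewrite tens_mid tensZl.
  by rewrite -hE (MN0 (tens m n)) raddf0.
apply: tens_ind => [t u -> ->|m]; first by rewrite addr0.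
apply: tens_ind => // t u Ht Hu; by rewrite tensDr Ht Hu addr0.
Qed.

(** * Quadruples *)

Record quad (R : comNzRingType) (A B : algType R)
    (N : bimodType A B) (M : bimodType B A) := Quad {
  qX : lmodType A;
  qY : lmodType B;
  qf : {linear tensor M qX -> qY};
  qg : {linear tensor N qY -> qX}
}.

(** The squares are asked to commute on pure tensors only; [hXgE] extends this to all tensors. *)
Record qhom (R : comNzRingType) (A B : algType R) (N : bimodType A B)
    (M : bimodType B A) (q q' : quad N M) := QHom {
  hX : {linear qX q -> qX q'};
  hY : {linear qY q -> qY q'};
  hXg : forall n y, hX (qg q (tens n y)) = qg q' (tens n (hY y));
  hYf : forall m x, hY (qf q (tens m x)) = qf q' (tens m (hX x))
}.

(** Exchanging the two rings lets each result about [qX] and [qg] be reused for [qY] and [qf]. *)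
Definition qswap (R : comNzRingType) (A B : algType R) (N : bimodType A B)
    (M : bimodType B A) (q : quad N M) : quad M N :=
  Quad (qg q) (qf q).

Definition hswap (R : comNzRingType) (A B : algType R) (N : bimodType A B)
    (M : bimodType B A) (q q' : quad N M) (h : qhom q q') :
    qhom (qswap q) (qswap q') :=
  @QHom _ _ _ _ _ (qswap q) (qswap q') (hY h) (hX h) (hYf h) (hXg h).

(** One-sided variants, since [qswap (qswap q)] reduces to [q] only once [q] is destructed. *)
Definition hswapl (R : comNzRingType) (A B : algType R) (N : bimodType A B)
    (M : bimodType B A) (q : quad N M) (q' : quad M N)
    (h : qhom (qswap q) q') : qhom q (qswap q') :=
  @QHom _ _ _ _ _ q (qswap q') (hY h) (hX h) (hYf h) (hXg h).

Definition hswapr (R : comNzRingType) (A B : algType R) (N : bimodType A B)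
    (M : bimodType B A) (q : quad N M) (q' : quad M N)
    (h : qhom q (qswap q')) : qhom (qswap q) q' :=
  @QHom _ _ _ _ _ (qswap q) q' (hY h) (hX h) (hYf h) (hXg h).

(* rho need not be unital: rho 1 is the idempotent that cuts out the corner. *)
Record corner_map (C S : pzRingType) := CornerMap {
  rho :> C -> S;
  rhoD : forall a b, rho (a + b) = rho a + rho b;
  rhoM : forall a b, rho (a * b) = rho a * rho b
}.

(** * Corners of a module cut out by an idempotent *)

Section Corner.
Variables (C S : pzRingType) (rho : corner_map C S) (L : lmodType S).

Definition corner_pred : {pred L} := fun x => rho 1 *: x == x.

Lemma corner_pred_closed : zmod_closed corner_pred.
Proof.
split; rewrite /corner_pred /in_mem /=; first by rewrite scaler0.
by move=> x y /eqP hx /eqP hy; apply/eqP; rewrite scalerBr hx hy.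
Qed.

HB.instance Definition _ :=
  GRing.isZmodClosed.Build L corner_pred corner_pred_closed.

Record corner : Type := Corner { corner_val : L; _ : corner_val \in corner_pred }.

HB.instance Definition _ := [isSub for corner_val].
HB.instance Definition _ := [Choice of corner by <:].
HB.instance Definition _ := [SubChoice_isSubZmodule of corner by <:].

Lemma corner_mem a (x : L) : rho 1 *: (rho a *: x) == rho a *: x.
Proof. by rewrite scalerA -rhoM mul1r. Qed.

Definition corner_scale (a : C) (x : corner) : corner :=
  Corner (corner_mem a (corner_val x) : _ \in corner_pred).

Lemma corner_scaleA a b x :
  corner_scale a (corner_scale b x) = corner_scale (a * b) x.
Proof. by apply: val_inj; rewrite /= scalerA rhoM. Qed.
Lemma corner_scale1 : left_id 1 corner_scale.
Proof. by case=> x h; apply: val_inj; apply/eqP/h. Qed.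
Lemma corner_scaleDr : right_distributive corner_scale +%R.
Proof. by move=> a x y; apply: val_inj; rewrite /= scalerDr. Qed.
Lemma corner_scaleDl x : {morph corner_scale^~ x : a b / a + b}.
Proof. by move=> a b; apply: val_inj; rewrite /= rhoD scalerDl. Qed.

HB.instance Definition _ := GRing.Zmodule_isLmodule.Build C corner
  corner_scaleA corner_scale1 corner_scaleDr corner_scaleDl.

End Corner.

(** * Quadruples as modules over the Morita ring *)

Section Quads.
Variables (R : comNzRingType) (A B : algType R).
Variables (N : bimodType A B) (M : bimodType B A).
Hypotheses (MN0 : zero_module (tensor M N)) (NM0 : zero_module (tensor N M)).
Implicit Types q : quad N M.

Definition qmod q : lmodType (morita N M) := quad_mod MN0 NM0 (qf q) (qg q).

Lemma quad_scaleE q (u : morita N M) (z : qmod q) :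
  u *: z = (m11 u *: z.1 + qg q (tens (m12 u) z.2),
            qf q (tens (m21 u) z.1) + m22 u *: z.2).
Proof. by []. Qed.

Lemma qmap_linear q q' (h : qhom q q') :
  linear (fun z : qmod q => (hX h z.1, hY h z.2) : qmod q').
Proof.
move=> u z z'; rewrite !quad_scaleE /=; congr (_, _).
- by rewrite !linearD linearZ_LR hXg.
- by rewrite !linearD linearZ_LR hYf.
Qed.

Definition qmap q q' (h : qhom q q') : {linear qmod q -> qmod q'} :=
  mklin (qmap_linear h).

(** A linear map commutes with the two diagonal idempotents, hence splits into components; commuting
    with the off-diagonal matrices makes them compatible with [qf] and [qg]. *)
Lemma qmap_ex q q' (h : {linear qmod q -> qmod q'}) :
  exists k : qhom q q', forall z, h z = qmap k z.
Proof.
have e1 (x : qX q) (y : qY q) : (mmx 1 0 0 0 : morita N M) *: ((x, y) : qmod q) = (x, 0).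
  by rewrite quad_scaleE /= /m11 /m12 /m21 /m22 /= !tens0l !linear0 scale1r scale0r !addr0.
have e2 (x : qX q) (y : qY q) : (mmx 0 0 0 1 : morita N M) *: ((x, y) : qmod q) = (0, y).
  by rewrite quad_scaleE /= /m11 /m12 /m21 /m22 /= !tens0l !linear0 scale1r scale0r !add0r.
have h1 x : h (x, 0) = ((h (x, 0)).1, 0).
  rewrite -{1}(e1 x 0) linearZ_LR quad_scaleE /= /m11 /m12 /m21 /m22 /=.
  by rewrite !tens0l !linear0 scale1r scale0r !addr0.
have h2 y : h (0, y) = (0, (h (0, y)).2).
  rewrite -{1}(e2 0 y) linearZ_LR quad_scaleE /= /m11 /m12 /m21 /m22 /=.
  by rewrite !tens0l !linear0 scale1r scale0r !add0r.
pose a (x : qX q) := (h (x, 0)).1; pose b (y : qY q) := (h (0, y)).2.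
have aL : linear a.
  move=> c x x'; rewrite /a.
  have -> : ((c *: x + x', 0) : qmod q) = mmx c 0 0 0 *: ((x, 0) : qmod q) + (x', 0).
    rewrite quad_scaleE /m11 /m12 /m21 /m22 /=; congr (_, _) => /=.
      by rewrite tens0l linear0 addr0.
    by rewrite tens0l linear0 scale0r !addr0.
  rewrite linearP quad_scaleE /= /m11 /m12 /m21 /m22 /=.
  by rewrite tens0l linear0 addr0.
have bL : linear b.
  move=> c x x'; rewrite /b.
  have -> : ((0, c *: x + x') : qmod q) = mmx 0 0 0 c *: ((0, x) : qmod q) + (0, x').
    rewrite quad_scaleE /m11 /m12 /m21 /m22 /=; congr (_, _) => /=.
      by rewrite tens0l linear0 scale0r !addr0.
    by rewrite tens0l linear0 add0r.
  rewrite linearP quad_scaleE /= /m11 /m12 /m21 /m22 /=.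
  by rewrite tens0l linear0 add0r.
have ag n y : mklin aL (qg q (tens n y)) = qg q' (tens n (mklin bL y)).
  rewrite /= /a.
  have -> : ((qg q (tens n y), 0) : qmod q) = mmx 0 n 0 0 *: ((0, y) : qmod q).
    rewrite quad_scaleE /m11 /m12 /m21 /m22 /=; congr (_, _) => /=.
      by rewrite scaler0 add0r.
    by rewrite tens0l linear0 scale0r addr0.
  rewrite linearZ_LR quad_scaleE /= /m11 /m12 /m21 /m22 /=.
  by rewrite scale0r add0r.
have bf m x : mklin bL (qf q (tens m x)) = qf q' (tens m (mklin aL x)).
  rewrite /= /b.
  have -> : ((0, qf q (tens m x)) : qmod q) = mmx 0 0 m 0 *: ((x, 0) : qmod q).
    rewrite quad_scaleE /m11 /m12 /m21 /m22 /=; congr (_, _) => /=.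
      by rewrite tens0l linear0 scale0r addr0.
    by rewrite scaler0 addr0.
  rewrite linearZ_LR quad_scaleE /= /m11 /m12 /m21 /m22 /=.
  by rewrite scale0r addr0.
exists (QHom ag bf) => -[x y] /=.
have -> : ((x, y) : qmod q) = (x, 0) + (0, y) by congr (_, _); rewrite /= ?addr0 ?add0r.
by rewrite linearD h1 h2; congr (_, _); rewrite /= ?addr0 ?add0r.
Qed.

(** The two diagonal idempotents split [L] into corners [X] and [Y]; the off-diagonal matrices carry
    one corner to the other and so define [f] and [g]. *)
Lemma quad_of (L : lmodType (morita N M)) :
  exists q (j : {linear qmod q -> L}), injective j /\ surj j.
Proof.
pose r1 (a : A) : morita N M := mmx a 0 0 0.
pose r2 (b : B) : morita N M := mmx 0 0 0 b.
have mmD a n m b a' n' m' b' :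
    (mmx a n m b : morita N M) + mmx a' n' m' b' = mmx (a + a') (n + n') (m + m') (b + b').
  by [].
have mmM a n m b a' n' m' b' :
    (mmx a n m b : morita N M) * mmx a' n' m' b' =
    mmx (a * a') (a *: n' + ract n b') (ract m a' + b *: m') (b * b').
  by [].
have ract0 (C D : algType R) (P : bimodType C D) (p : P) : ract p 0 = 0.
  by apply: (addrI (ract p 0)); rewrite -ractDr !addr0.
pose simp := (mmM, ract0, ract0l, scale0r, scaler0, mulr0, mul0r, addr0, add0r,
  scale1r, ract1, mul1r, mulr1).
have r1D a b : r1 (a + b) = r1 a + r1 b by rewrite /r1 mmD !addr0.
have r2D a b : r2 (a + b) = r2 a + r2 b by rewrite /r2 mmD !addr0.
have r1M a b : r1 (a * b) = r1 a * r1 b by rewrite /r1 !simp.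
have r2M a b : r2 (a * b) = r2 a * r2 b by rewrite /r2 !simp.
pose c1 := CornerMap r1D r1M; pose c2 := CornerMap r2D r2M.
pose X : lmodType A := corner c1 L; pose Y : lmodType B := corner c2 L.
have valX (a : A) (x : X) : corner_val (a *: x) = r1 a *: corner_val x by [].
have valY (b : B) (y : Y) : corner_val (b *: y) = r2 b *: corner_val y by [].
have valXD (x x' : X) : corner_val (x + x') = corner_val x + corner_val x' by [].
have valYD (y y' : Y) : corner_val (y + y') = corner_val y + corner_val y' by [].
have cX (x : X) : r1 1 *: corner_val x = corner_val x by case: x => x h; apply/eqP/h.
have cY (y : Y) : r2 1 *: corner_val y = corner_val y by case: y => y h; apply/eqP/h.
pose mu m : morita N M := mmx 0 0 m 0; pose nu n : morita N M := mmx 0 n 0 0.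
have fP m (x : L) : r2 1 *: (mu m *: x) == mu m *: x.
  by rewrite scalerA /r2 /mu !simp.
have gP n (x : L) : r1 1 *: (nu n *: x) == nu n *: x.
  by rewrite scalerA /r1 /nu !simp.
pose fb m (x : X) : Y := Corner (fP m (corner_val x) : _ \in corner_pred c2 (L := L)).
pose gb n (y : Y) : X := Corner (gP n (corner_val y) : _ \in corner_pred c1 (L := L)).
have [||||f fE] := @tensor_lift_linear _ _ _ M X Y fb.
- by move=> m m' x; apply: val_inj; rewrite /= -scalerDl mmD !addr0.
- by move=> m x x'; apply: val_inj; exact: (scalerDr (mu m) (corner_val x) (corner_val x')).
- by move=> m a x; apply: val_inj; rewrite /= scalerA /mu /r1 !simp.
- by move=> b m x; apply: val_inj; rewrite /= scalerA /mu /r2 !simp.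
have [||||g gE] := @tensor_lift_linear _ _ _ N Y X gb.
- by move=> m m' x; apply: val_inj; rewrite /= -scalerDl mmD !addr0.
- by move=> m x x'; apply: val_inj; exact: (scalerDr (nu m) (corner_val x) (corner_val x')).
- by move=> m a x; apply: val_inj; rewrite /= scalerA /nu /r2 !simp.
- by move=> b m x; apply: val_inj; rewrite /= scalerA /nu /r1 !simp.
pose q : quad N M := Quad f g.
pose j (z : qmod q) : L := corner_val (z.1 : X) + corner_val (z.2 : Y).
have jL : linear j.
  move=> u [x y] [x' y']; rewrite quad_scaleE /j /= fE gE.
  set vx := corner_val x; set vy := corner_val y.
  change (r1 (m11 u) *: vx + nu (m12 u) *: vy + corner_val x' +
    (mu (m21 u) *: vx + r2 (m22 u) *: vy + corner_val y') =
    u *: (vx + vy) + (corner_val x' + corner_val y')).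
  (* Inserting the idempotent that fixes [vx] shows that [u] acts on it through its first column
     only. *)
  have ux : u *: vx = r1 (m11 u) *: vx + mu (m21 u) *: vx.
    rewrite -[vx in LHS](cX x) scalerA -scalerDl; congr (_ *: _).
    by case: u => [[a n] [m b]]; rewrite -/(mmx a n m b) /r1 mmD !simp.
  have uy : u *: vy = nu (m12 u) *: vy + r2 (m22 u) *: vy.
    rewrite -[vy in LHS](cY y) scalerA -scalerDl; congr (_ *: _).
    by case: u {ux} => [[a n] [m b]]; rewrite -/(mmx a n m b) /r2 mmD !simp.
  by rewrite scalerDr ux uy addrACA; congr (_ + _); rewrite addrACA.
exists q, (mklin jL); split.
- apply: linear_inj => -[x y] /=; rewrite /j /= => h.
  have hx : corner_val x = 0.
    have := congr1 (fun z => r1 1 *: z) h.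
    by rewrite /= scalerDr cX -(cY y) scalerA /r1 /r2 !simp.
  have hy : corner_val y = 0 by move: h; rewrite hx add0r.
  by congr (_, _); apply: val_inj.
- move=> z.
  have p1 : r1 1 *: (r1 1 *: z) == r1 1 *: z by rewrite scalerA -r1M mulr1.
  have p2 : r2 1 *: (r2 1 *: z) == r2 1 *: z by rewrite scalerA -r2M mulr1.
  exists (Corner (p1 : _ \in corner_pred c1 (L := L)),
          Corner (p2 : _ \in corner_pred c2 (L := L))).
  rewrite /= /j /= -scalerDl mmD !addr0 !add0r.
  exact: scale1r.
Qed.

End Quads.

(** * Exactness, projectivity and Gorenstein-projectivity of quadruples *)

Section QuadExact.
Variables (R : comNzRingType) (A B : algType R).
Variables (N : bimodType A B) (M : bimodType B A).
Implicit Types q K P Q : quad N M.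

Definition qexact q1 q2 q3 (i : qhom q1 q2) (p : qhom q2 q3) :=
  exact (hX i) (hX p) /\ exact (hY i) (hY p).

Definition qextends K P (i : qhom K P) Q := forall h : qhom K Q,
  exists k : qhom P Q, (forall x, hX k (hX i x) = hX h x) /\
                       (forall y, hY k (hY i y) = hY h y).

Definition qlifts P := forall q q' (p : qhom q q') (h : qhom P q'),
  surj (hX p) -> surj (hY p) ->
  exists k : qhom P q, (forall x, hX p (hX k x) = hX h x) /\
                       (forall y, hY p (hY k y) = hY h y).

Hypotheses (MN0 : zero_module (tensor M N)) (NM0 : zero_module (tensor N M)).
Local Notation qmod := (qmod MN0 NM0).
Local Notation qmap := (qmap MN0 NM0).

Lemma qmap_inj q q' (h : qhom q q') :
  injective (qmap h) <-> injective (hX h) /\ injective (hY h).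
Proof.
split=> [ih|[ix iy] [x y] [x' y'] /= [/ix-> /iy->] //]; split=> x x' e.
- by have [] : (x, 0) = (x', 0) :> qmod q by apply: ih; rewrite /= e.
- by have [] : (0, x) = (0, x') :> qmod q by apply: ih; rewrite /= e.
Qed.

Lemma qmap_surj q q' (h : qhom q q') :
  surj (qmap h) <-> surj (hX h) /\ surj (hY h).
Proof.
split=> [sh|[sx sy] [x y]]; last first.
  by have [x' <-] := sx x; have [y' <-] := sy y; exists (x', y').
split=> x; first by have [[x' y'] /= [<- _]] := sh (x, 0); exists x'.
by have [[x' y'] /= [_ <-]] := sh (0, x); exists y'.
Qed.

Lemma qexactP q1 q2 q3 (i : qhom q1 q2) (p : qhom q2 q3) :
  exact (qmap i) (qmap p) <-> qexact i p.
Proof.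
split=> [[/qmap_inj[ix iy] /qmap_surj[sx sy] ex]|[[ix sx ex] [iy sy ey]]].
  split; split=> // z; split.
  - move=> pz; have [|[x y] /= [e _]] := (ex (z, 0)).1; last by exists x.
    by rewrite /= pz linear0.
  - move=> [x <-]; have /(ex _).2/(congr1 fst)// : exists v, qmap i v = (hX i x, 0).
    by exists (x, 0); rewrite /= linear0.
  - move=> pz; have [|[x y] /= [_ e]] := (ex (0, z)).1; last by exists y.
    by rewrite /= pz linear0.
  - move=> [x <-]; have /(ex _).2/(congr1 snd)// : exists v, qmap i v = (0, hY i x).
    by exists (0, x); rewrite /= linear0.
split; first exact/qmap_inj.
  exact/qmap_surj.
move=> [x y]; split=> /= [[/ex[x' <-] /ey[y' <-]]|[[x' y'] /= [<- <-]]].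
  by exists (x', y').
have /ex -> : exists v, hX i v = hX i x' by exists x'.
by have /ey -> : exists v, hY i v = hY i y' by exists y'.
Qed.

Lemma qextendsP K P (i : qhom K P) Q :
  extends (qmap i) (qmod Q) <-> qextends i Q.
Proof.
split=> [e h|e h].
  have [k kE] := e (qmap h); have [k' k'E] := qmap_ex k.
  exists k'; split=> x.
    by have := kE (x, 0); rewrite k'E /= => -[].
  by have := kE (0, x); rewrite k'E /= => -[].
have [h' h'E] := qmap_ex h; have [k [kX kY]] := e h'.
by exists (qmap k) => -[x y]; rewrite h'E /= kX kY.
Qed.

(** By [quad_of] any lifting problem is isomorphic to one between quadruples. *)
Lemma qliftsP P : projective (qmod P) <-> qlifts P.
Proof.
split=> [pP q q' p h sx sy|pP V W p h sp].
  have [|k kE] := pP _ _ (qmap p) (qmap h); first exact/qmap_surj.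
  have [k' k'E] := qmap_ex k; exists k'; split=> x.
    by have := kE (x, 0); rewrite k'E /= => -[].
  by have := kE (0, x); rewrite k'E /= => -[].
have [q [j [ij sj]]] := quad_of MN0 NM0 V.
have [q' [j' [ij' sj']]] := quad_of MN0 NM0 W.
have [l [jl lj]] := linear_inv ij' sj'.
have [p' p'E] := qmap_ex (l \o p \o j).
have [h' h'E] := qmap_ex (l \o h).
have /qmap_surj[sx sy] : surj (qmap p').
  move=> z; have [v vE] := sp (j' z); have [u uE] := sj v.
  by exists u; rewrite -p'E /= uE vE jl.
have [k [kX kY]] := pP _ _ p' h' sx sy.
exists (j \o qmap k) => z; apply: (can_inj lj).
have -> : l (h z) = qmap h' z by rewrite -h'E.
have -> : l (p ((j \o qmap k) z)) = qmap p' (qmap k z) by rewrite -p'E.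
by case: z => x y; rewrite /= kX kY.
Qed.

Definition qfgproj q := fgproj (qmod q).
Definition qgp q := gorenstein_projective (qmod q).

Definition has_qnext (D : quad N M -> Prop) q :=
  exists P q' (i : qhom q P) (p : qhom P q'),
    [/\ qfgproj P, qexact i p & D q'].

Definition has_qprev (D : quad N M -> Prop) q :=
  exists K P (i : qhom K P) (p : qhom P q),
    [/\ qfgproj P, qexact i p, D K & forall Q, qfgproj Q -> qextends i Q].

Definition qgp_class (D : quad N M -> Prop) :=
  forall q, D q -> has_qnext D q /\ has_qprev D q.

(** The modules isomorphic to a quadruple in [D] form a class to which [gp_intro] applies. *)
Lemma qgp_intro D q : qgp_class D -> D q -> qgp q.
Proof.
move=> gD Dq; apply: (@gp_intro _ (fun L => exists q (j : {linear qmod q -> L}),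
  [/\ D q, injective j & surj j])); last first.
  by exists q, idfun; split=> // z; exists z.
move=> {q Dq} L [q [j [Dq ij sj]]].
have [[P [q' [i [p [fP /qexactP ex Dq']]]]]
      [K [P' [i' [p' [fP' /qexactP ex' DK e]]]]]] := gD _ Dq.
split.
  have [l [jl lj]] := linear_inv ij sj.
  exists (qmod P), (qmod q'), (qmap i \o l), (qmap p); split=> //.
    apply: exact_iso_l => //; first exact: can_inj lj.
    by move=> z; exists (j z).
  by exists q', idfun; split=> // z; exists z.
exists (qmod K), (qmod P'), (qmap i'), (j \o qmap p'); split=> //.
- exact: exact_iso_r.
- by exists K, idfun; split=> // z; exists z.
move=> Q fQ; have [Q' [k [ik sk]]] := quad_of MN0 NM0 Q.
apply: (extends_iso ik sk); apply/qextendsP/e.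
have [l [kl lk]] := linear_inv ik sk.
by apply: fgproj_iso fQ; [apply: can_inj lk | move=> z; exists (k z)].
Qed.

Lemma qgp_iso q (L : lmodType (morita N M)) (j : {linear qmod q -> L}) :
  injective j -> surj j -> gorenstein_projective L -> qgp q.
Proof. by move=> ij sj; apply: gp_iso ij sj. Qed.

(** Only the middle module is replaced by a new quadruple, the ends being prescribed. The last
    clause identifies the first map, which is what transports the extension property. *)
Lemma qses_of (L1 L2 L3 : lmodType (morita N M)) q1 q3 (i : {linear L1 -> L2})
    (p : {linear L2 -> L3}) (j1 : {linear qmod q1 -> L1})
    (j3 : {linear L3 -> qmod q3}) :
  injective j1 -> surj j1 -> injective j3 -> surj j3 -> exact i p ->
  exists q2 (j2 : {linear qmod q2 -> L2}) (i' : qhom q1 q2) (p' : qhom q2 q3),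
    [/\ injective j2, surj j2, qexact i' p' &
      forall z, j2 (qmap i' z) = i (j1 z)].
Proof.
move=> ij1 sj1 ij3 sj3 ex; have [q2 [j [ij sj]]] := quad_of MN0 NM0 L2.
have [l [jl lj]] := linear_inv ij sj.
have [i' i'E] := qmap_ex (l \o (i \o j1)).
have [p' p'E] := qmap_ex (j3 \o (p \o j)).
exists q2, j, i', p'; split=> // [|z]; last by rewrite -i'E /= lj.
apply/qexactP.
have [ii sp e] : exact (l \o (i \o j1)) (j3 \o (p \o j)).
  apply: exact_iso_r => //.
  by apply: exact_iso_m => //; apply: exact_iso_l.
split=> [x y||w].
- by rewrite -!i'E => /ii.
- by move=> u; have [w <-] := sp u; exists w; rewrite -p'E.
- by rewrite -p'E e; split=> -[v <-]; exists v; rewrite i'E.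
Qed.

Lemma qgp_unfold : qgp_class qgp.
Proof.
move=> q /gp_unfold[[P [L [i [p [fP ex gL]]]]] [K [P' [i' [p' [fP' ex' gK e]]]]]].
have idS q' : surj (idfun : {linear qmod q' -> qmod q'}) by move=> z; exists z.
split.
  have [q' [j [ij sj]]] := quad_of MN0 NM0 L.
  have [l [jl lj]] := linear_inv ij sj.
  have [|||| P2 [j2 [i2 [p2 [ij2 sj2 ex2 _]]]]] :=
    @qses_of _ _ _ q q' i p idfun l _ _ _ _ ex => //.
  - exact: can_inj lj.
  - by move=> z; exists (j z).
  have [l2 [jl2 lj2]] := linear_inv ij2 sj2.
  exists P2, q', i2, p2; split=> //; last exact: qgp_iso ij sj gL.
  by apply: fgproj_iso fP; [apply: can_inj lj2 | move=> z; exists (j2 z)].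
have [K2 [k [ik sk]]] := quad_of MN0 NM0 K.
have [|||| P2 [j2 [i2 [p2 [ij2 sj2 ex2 jE]]]]] :=
    @qses_of _ _ _ K2 q i' p' k idfun _ _ _ _ ex' => //.
have [l2 [jl2 lj2]] := linear_inv ij2 sj2.
have [l [kl lk]] := linear_inv ik sk.
exists K2, P2, i2, p2; split=> //; last first.
- move=> Q fQ; apply/qextendsP => h.
  have [m mE] := e _ fQ (h \o l).
  by exists (m \o j2) => z; rewrite /= jE mE /= kl.
- exact: qgp_iso ik sk gK.
by apply: fgproj_iso fP'; [apply: can_inj lj2 | move=> z; exists (j2 z)].
Qed.

End QuadExact.

Lemma qfgproj_swap (R : comNzRingType) (A B : algType R)
    (N : bimodType A B) (M : bimodType B A)
    (MN0 : zero_module (tensor M N)) (NM0 : zero_module (tensor N M))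
    (q : quad N M) :
  qfgproj MN0 NM0 q -> qfgproj NM0 MN0 (qswap q).
Proof.
move=> [[n [e eE]] /qliftsP pq]; split; last first.
  apply/qliftsP => q1 q2 p h sX sY.
  have [k [kX kY]] := pq (qswap q1) (qswap q2) (hswap p)
    (hswapl h) sY sX.
  by exists (hswapr k).
exists n, (fun i => ((e i).2, (e i).1)) => -[y x].
have [c cE] := eE (x, y).
(* Exchanging the indices 1 and 2 turns a matrix of [morita N M] into one of [morita M N]. *)
exists (fun i => mmx (m22 (c i)) (m21 (c i)) (m12 (c i)) (m11 (c i))).
have [/= -> ->] : ((x, y) : qmod MN0 NM0 q) =
    (\sum_(i < n) (c i *: e i).1, \sum_(i < n) (c i *: e i).2).
  rewrite [LHS]cE [LHS]surjective_pairing; congr (_, _).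
    exact: (big_morph (fun z : qmod MN0 NM0 q => z.1) (fun _ _ => erefl) erefl).
  exact: (big_morph (fun z : qmod MN0 NM0 q => z.2) (fun _ _ => erefl) erefl).
rewrite [RHS]surjective_pairing; congr (_, _).
  rewrite (big_morph (fun z : qmod NM0 MN0 (qswap q) => z.1) (fun _ _ => erefl) erefl).
  by apply: eq_bigr => i _; rewrite !quad_scaleE /= addrC.
rewrite (big_morph (fun z : qmod NM0 MN0 (qswap q) => z.2) (fun _ _ => erefl) erefl).
by apply: eq_bigr => i _; rewrite !quad_scaleE /= addrC.
Qed.

(** The two quadruples live over different rings; swapping preserves projectivity, exactness and
    extension of maps, so the quadruples with Gorenstein-projective swap form a class for
    [qgp_intro]. *)
Lemma qgp_swap (R : comNzRingType) (A B : algType R)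
    (N : bimodType A B) (M : bimodType B A)
    (MN0 : zero_module (tensor M N)) (NM0 : zero_module (tensor N M))
    (q : quad N M) :
  qgp MN0 NM0 q -> qgp NM0 MN0 (qswap q).
Proof.
move=> gq; apply: (@qgp_intro _ _ _ _ _ _ _ (fun q' => qgp MN0 NM0 (qswap q'))).
  move=> {gq} q' /qgp_unfold[[P [q2 [i [p [fP ex gq2]]]]] [K [P' [i' [p' [fP' ex' gK e]]]]]].
  split.
    exists (qswap P), (qswap q2), (hswapl i), (hswap p).
    by split; [apply: qfgproj_swap | case: ex | case: q2 p gq2 ex].
  exists (qswap K), (qswap P'), (hswap i'), (hswapr p').
  split; [exact: qfgproj_swap | by case: ex' | by case: K i' gK e ex' |].
  move=> Q fQ h; have [k [kX kY]] := e _ (qfgproj_swap fQ) (hswapl h).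
  by exists (hswapr k).
by case: q gq.
Qed.

(** * Projective quadruples *)

Section PairLinear.
Variables (S : pzRingType) (U V : lmodType S).

Lemma pairl_linear : linear (fun u : U => (u, 0) : U * V).
Proof. by move=> a x y; congr (_, _); rewrite /= scaler0 addr0. Qed.
Definition pairl : {linear U -> (U * V)%type} := mklin pairl_linear.

Lemma pairr_linear : linear (fun v : V => (0, v) : U * V).
Proof. by move=> a x y; congr (_, _); rewrite /= scaler0 addr0. Qed.
Definition pairr : {linear V -> (U * V)%type} := mklin pairr_linear.

Lemma pair_exact : exact pairr (@fst U V).
Proof.
split=> [x y [] //|u|[u v] /=]; first by exists (u, 0).
by split=> [->|[w [-> _]]]; [exists v | ].
Qed.

Lemma fg_prod : fg U -> fg V -> fg (U * V)%type.
Proof.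
move=> /fg_span[s sE] /fg_span[r rE]; apply/fg_span.
exists (map pairl s ++ map pairr r) => P P0 PD Ps.
have P1 : forall u, P (pairl u).
  apply: sE => [|a x y Px Py|x xs]; first by rewrite linear0.
    by rewrite linearP; apply: PD.
  by apply: Ps; rewrite mem_cat map_f.
have P2 : forall u, P (pairr u).
  apply: rE => [|a x y Px Py|x xs]; first by rewrite linear0.
    by rewrite linearP; apply: PD.
  by apply: Ps; rewrite mem_cat map_f ?orbT.
move=> [u v]; have -> : (u, v) = 1 *: pairl u + pairr v.
  by congr (_, _); rewrite /= ?scale1r ?addr0 ?scaler0 ?add0r.
exact: PD.
Qed.

End PairLinear.
Arguments pairl {S} U V.
Arguments pairr {S} U V.

Definition zeromod (S : pzRingType) : lmodType S := 'rV[S]_0.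

Lemma zeromod0 (S : pzRingType) : zero_module (zeromod S).
Proof. by move=> v; apply/rowP => -[]. Qed.

Lemma fgproj_zero (S : pzRingType) : fgproj (zeromod S).
Proof.
split; first by exists 0%N, (fun=> 0) => v; exists (fun=> 0); rewrite (zeromod0 v) big_ord0.
by move=> V W p h _; exists \0 => x; rewrite (zeromod0 x) !linear0.
Qed.

Lemma tensor_zero (R : comNzRingType) (B A : algType R) (M : bimodType B A)
    (X : lmodType A) : zero_module X -> zero_module (tensor M X).
Proof.
move=> X0; apply: tens_ind => [t u -> ->|m x]; first by rewrite addr0.
by rewrite (X0 x); apply: (addrI (tens m 0)); rewrite -tensDr !addr0.
Qed.

Section Free.
Variables (R : comNzRingType) (A B : algType R).
Variables (N : bimodType A B) (M : bimodType B A).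
Implicit Types (P : lmodType A) (Q : lmodType B) (q : quad N M).

(** The structure map of the quadruple generated by [P] and [Q]: it drops the summand N (x) (M (x)
    P), which is zero when N (x) M is. *)
Definition free_map P Q :
    {linear tensor N (Q * tensor M P)%type -> (P * tensor N Q)%type} :=
  pairr P (tensor N Q) \o tmap N (@fst Q (tensor M P)).

Lemma free_mapE P Q n z : free_map P Q (tens n z) = (0, tens n z.1).
Proof. by rewrite /= tmapE. Qed.

(** The kernel of N (x) v is the image of N (x) (M (x) X), which is zero. *)
Lemma tmap_coker_inj (hN : fgproj (right_mod N)) (NM0 : zero_module (tensor N M))
    q (V : lmodType B) (v : {linear qY q -> V}) :
  exact (qf q) v -> injective (tmap N v).
Proof.
move=> /(tensor_exact hN)[_ _ ex]; apply: linear_inj => t /ex[w <-].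
by rewrite (tensor_tensor0 NM0 w) linear0.
Qed.

Lemma free_map_exact (hN : fgproj (right_mod N)) (NM0 : zero_module (tensor N M))
    P Q : exact (free_map P Q) (@fst P (tensor N Q)).
Proof.
have [_ st et] := tensor_exact hN (pair_exact Q (tensor M P)).
split=> [|u|[u v] /=]; last 1 first.
- split=> [->|[t [-> _]] //].
  by have [t <-] := st v; exists t.
- apply: linear_inj => t [/et[w <-]].
  by rewrite (tensor_tensor0 NM0 w) linear0.
- by exists (u, 0).
Qed.

Lemma qgf0 (NM0 : zero_module (tensor N M)) q n t : qg q (tens n (qf q t)) = 0.
Proof.
elim/tens_ind: t => [t u|m x]; last exact: quad_gf0.
by rewrite linearD tensDr linearD => -> ->; rewrite addr0.
Qed.

Lemma hXgE q q' (h : qhom q q') t :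
  hX h (qg q t) = qg q' (tmap N (hY h) t).
Proof.
apply: (tensor_ext (g := hX h \o qg q) (h := qg q' \o tmap N (hY h))) => n y /=.
by rewrite hXg tmapE.
Qed.

(** The X-component of the map out of a free quadruple that [a] and [b] determine. *)
Definition free_X q P Q (a : {linear P -> qX q}) (b : {linear Q -> qY q}) :
    {linear (P * tensor N Q)%type -> qX q} :=
  (a \o @fst P (tensor N Q)) \+ (qg q \o tmap N b \o @snd P (tensor N Q)).

End Free.

Section FreeQuad.
Variables (R : comNzRingType) (A B : algType R).
Variables (N : bimodType A B) (M : bimodType B A).
Hypothesis NM0 : zero_module (tensor N M).

(** The two sides differ by a term [qg q (tens n (qf q _))], which vanishes by [qgf0]. *)
Lemma free_X_compat (P : lmodType A) (Q : lmodType B) (q : quad N M)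
    (a : {linear P -> qX q}) (b : {linear Q -> qY q}) n z :
  free_X a b (free_map N M P Q (tens n z)) =
  qg q (tens n (free_X (q := qswap q) b a z)).
Proof.
rewrite free_mapE /= linear0 add0r tmapE tensDr linearD.
by rewrite (qgf0 NM0) addr0.
Qed.

End FreeQuad.

Section QuadConstructions.
Variables (R : comNzRingType) (A B : algType R).
Variables (N : bimodType A B) (M : bimodType B A).
Hypotheses (MN0 : zero_module (tensor M N)) (NM0 : zero_module (tensor N M)).
Implicit Types (P : lmodType A) (Q : lmodType B) (q : quad N M).

(* The direct sum of (P, M (x) P)_(id, 0) and (N (x) Q, Q)_(0, id). *)
Definition qfree P Q : quad N M := Quad (free_map M N Q P) (free_map N M P Q).

Definition free_hom P Q q (a : {linear P -> qX q}) (b : {linear Q -> qY q}) :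
    qhom (qfree P Q) q :=
  @QHom _ _ _ _ _ (qfree P Q) q (free_X a b) (free_X (q := qswap q) b a)
    (free_X_compat NM0 a b) (free_X_compat MN0 (q := qswap q) b a).

(** Here and in the next compatibility lemmas only the X half is shown; the Y half is obtained from
    the swapped maps. *)
Lemma hom_comp_compat q q' q'' (h : qhom q q') (k : qhom q' q'') n y :
  (hX k \o hX h) (qg q (tens n y)) = qg q'' (tens n ((hY k \o hY h) y)).
Proof. by rewrite /= !hXg. Qed.

Lemma hom_add_compat q q' (h k : qhom q q') n y :
  (hX h \+ hX k) (qg q (tens n y)) = qg q' (tens n ((hY h \+ hY k) y)).
Proof. by rewrite /= !hXg tensDr linearD. Qed.

Lemma tensNr (Y : lmodType B) (n : N) (y : Y) : tens n (- y) = - tens n y.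
Proof.
apply: (addrI (tens n y)); rewrite -tensDr !subrr.
by apply: (addrI (tens n 0)); rewrite -tensDr !addr0.
Qed.

Lemma hom_sub_compat q q' (h k : qhom q q') n y :
  (hX h \- hX k) (qg q (tens n y)) = qg q' (tens n ((hY h \- hY k) y)).
Proof. by rewrite /= !hXg tensDr tensNr linearB. Qed.

(** A map out of a free quadruple is determined on [P] and [Q], because the summand N (x) Q is the
    image of the structure map. *)
Lemma free_hom_ext P Q q (h : qhom (qfree P Q) q) z :
  hX h z = hX h (z.1, 0) + qg q (tmap N (hY h \o pairl Q (tensor M P)) z.2).
Proof.
case: z => x t /=.
have -> : (x, t) = (x, 0) + (0, t) :> P * tensor N Q.
  by congr (_, _); rewrite /= ?addr0 ?add0r.
rewrite linearD; congr (_ + _).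
rewrite -(@tmap_comp _ _ _ N _ _ _ (pairl Q (tensor M P)) (hY h)) //.
rewrite -(hXgE h) /=; congr (hX h (_, _)).
by rewrite (tmap_comp (l := idfun)) // tmap_id.
Qed.

End QuadConstructions.

Section QuadOps.
Variables (R : comNzRingType) (A B : algType R).
Variables (N : bimodType A B) (M : bimodType B A).
Hypotheses (MN0 : zero_module (tensor M N)) (NM0 : zero_module (tensor N M)).
Implicit Types (P : lmodType A) (Q : lmodType B) (q : quad N M).

Definition qcomp q q' q'' (h : qhom q q') (k : qhom q' q'') : qhom q q'' :=
  QHom (hom_comp_compat h k) (hom_comp_compat (hswap h) (hswap k)).

Definition qadd q q' (h k : qhom q q') : qhom q q' :=
  QHom (hom_add_compat h k) (hom_add_compat (hswap h) (hswap k)).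

Definition qsub q q' (h k : qhom q q') : qhom q q' :=
  QHom (hom_sub_compat h k) (hom_sub_compat (hswap h) (hswap k)).

Lemma qfree_lifts P Q : projective P -> projective Q -> qlifts (qfree N M P Q).
Proof.
move=> pP pQ q q' p h sX sY.
have [a aE] := pP _ _ (hX p) (hX h \o pairl _ _) sX.
have [b bE] := pQ _ _ (hY p) (hY h \o pairl _ _) sY.
exists (free_hom MN0 NM0 a b); split=> z.
  rewrite [RHS](free_hom_ext h) /= linearD aE /=; congr (_ + _).
  by rewrite hXgE; congr (qg q' _); apply: tmap_comp.
rewrite [RHS](free_hom_ext (hswap h)) /= linearD bE /=; congr (_ + _).
by rewrite (hXgE (hswap p)); congr (qf q' _); apply: tmap_comp.
Qed.

Lemma fg_qmod q : fg (qX q) -> fg (qY q) -> fg (qmod MN0 NM0 q).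
Proof.
move=> /fg_span[s sE] /fg_span[r rE]; apply/fg_span.
exists ([seq (x, 0) : qmod MN0 NM0 q | x <- s] ++
        [seq (0, y) : qmod MN0 NM0 q | y <- r]) => T T0 TD Ts.
have T1 : forall x, T (x, 0).
  apply: sE => [|a x x' Tx Tx'|x xs] //; last by apply: Ts; rewrite mem_cat map_f.
  have := TD (mmx a 0 0 0) _ _ Tx Tx'; rewrite quad_scaleE !mmxE /=.
  by rewrite !tens0l !linear0 scale0r !addr0; congr T; congr (_, _); rewrite /= ?addr0.
have T2 : forall y, T (0, y).
  apply: rE => [|a x x' Tx Tx'|x xs] //; last by apply: Ts; rewrite mem_cat map_f ?orbT.
  have := TD (mmx 0 0 0 a) _ _ Tx Tx'; rewrite quad_scaleE !mmxE /=.
  by rewrite !tens0l !linear0 scale0r !add0r; congr T; congr (_, _); rewrite /= ?add0r.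
move=> [x y]; have := TD 1 _ _ (T1 x) (T2 y); rewrite scale1r.
by congr T; congr (_, _); rewrite /= ?addr0 ?add0r.
Qed.

Hypotheses (hM : fgproj M) (hN : fgproj N).
Hypotheses (hMr : fgproj (right_mod M)) (hNr : fgproj (right_mod N)).

Lemma qfree_fgproj P Q : fgproj P -> fgproj Q -> qfgproj MN0 NM0 (qfree N M P Q).
Proof.
move=> hP hQ; split; last by apply/qliftsP; apply: qfree_lifts; [case: hP | case: hQ].
have [fN _] := fgproj_tensor hN hQ; have [fM _] := fgproj_tensor hM hP.
by apply: fg_qmod => /=; apply: fg_prod => //; [case: hP | case: hQ].
Qed.

(** The identity lifts along the surjection onto [q] from the free quadruple on its own two
    components, whose structure map is injective by [free_map_exact]. *)
Lemma qfgproj_monic q : qfgproj MN0 NM0 q -> injective (qg q).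
Proof.
move=> [_ /qliftsP lq].
have idL (S : pzRingType) (V : lmodType S) : linear (fun x : V => x) by [].
pose p := free_hom MN0 NM0 (mklin (idL _ (qX q))) (mklin (idL _ (qY q))).
pose h : qhom q q := @QHom _ _ _ _ _ q q (mklin (idL _ (qX q))) (mklin (idL _ (qY q)))
  (fun _ _ => erefl) (fun _ _ => erefl).
have [x|y|k [kX kY]] := lq _ _ p h.
- by exists (x, 0); rewrite /= !linear0 addr0.
- by exists (y, 0); rewrite /= !linear0 addr0.
apply: linear_inj => t t0.
have [ii _ _] := free_map_exact hNr NM0 (qX q) (qY q).
have : free_map N M (qX q) (qY q) (tmap N (hY k) t) = 0.
  by rewrite -[LHS](hXgE k) t0 linear0.
move/(linear_inj0 ii) => kt.
rewrite -[t]tmap_id -(tmap_comp (h := hY k) (k := hY p)) ?kt ?linear0 //.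
Qed.

(** Embed [q] into a projective quadruple: N (x) - keeps the Y-embedding injective, and the
    structure map of the target is injective. *)
Lemma qgp_monic q : qgp MN0 NM0 q -> injective (qg q).
Proof.
move=> /qgp_unfold[[P [q' [i [p [/qfgproj_monic iP [[iX _ _] exY] _]]]]] _].
have [it _ _] := tensor_exact hNr exY.
apply: linear_inj => t t0; apply: (linear_inj0 it); apply: (linear_inj0 iP).
by rewrite -hXgE t0 linear0.
Qed.

End QuadOps.

(** * Cokernels of Gorenstein-projective quadruples *)

Section KernelCokernel.
Variables (R : comNzRingType) (A B : algType R) (N : bimodType A B).
Hypothesis hNr : fgproj (right_mod N).
Variables (X1 X2 X3 : lmodType A) (Y1 Y2 Y3 : lmodType B).
Variables (iX : {linear X1 -> X2}) (pX : {linear X2 -> X3}).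
Variables (iY : {linear Y1 -> Y2}) (pY : {linear Y2 -> Y3}).
Hypotheses (exX : exact iX pX) (exY : exact iY pY).
Variable g2 : {linear tensor N Y2 -> X2}.

Lemma map_coker (g1 : {linear tensor N Y1 -> X1}) :
  (forall n y, iX (g1 (tens n y)) = g2 (tens n (iY y))) ->
  exists g3 : {linear tensor N Y3 -> X3},
    forall n y, pX (g2 (tens n y)) = g3 (tens n (pY y)).
Proof.
move=> gE; have [_ st et] := tensor_exact hNr exY.
have [|g3 g3E] := @factor_surj _ _ _ _ (tmap N pY) (pX \o g2) st.
  move=> t /et[u <-] /=.
  have -> : g2 (tmap N iY u) = iX (g1 u).
    apply: (tensor_ext (g := g2 \o tmap N iY) (h := iX \o g1)) => n y /=.
    by rewrite tmapE gE.
  exact: exact_comp0 exX.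
by exists g3 => n y; rewrite -tmapE g3E.
Qed.

Lemma map_ker (g3 : {linear tensor N Y3 -> X3}) :
  (forall n y, pX (g2 (tens n y)) = g3 (tens n (pY y))) ->
  exists g1 : {linear tensor N Y1 -> X1},
    forall n y, iX (g1 (tens n y)) = g2 (tens n (iY y)).
Proof.
move=> gE; case: exX => ii _ ex.
have [|g1 g1E] := @factor_inj _ _ _ _ iX (g2 \o tmap N iY) ii.
  move=> t; apply/ex; rewrite /=.
  have [_ _ et] := tensor_exact hNr exY.
  have /et e : exists u, tmap N iY u = tmap N iY t by exists t.
  rewrite -[RHS](linear0 g3) -[in RHS]e.
  apply: (tensor_ext (g := pX \o g2) (h := g3 \o tmap N pY)) => n y /=.
  by rewrite tmapE gE.
by exists g1 => n y; rewrite g1E /= tmapE.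
Qed.

End KernelCokernel.

Section Cokernels.
Variables (R : comNzRingType) (A B : algType R).
Variables (N : bimodType A B) (M : bimodType B A).
Hypotheses (MN0 : zero_module (tensor M N)) (NM0 : zero_module (tensor N M)).
Hypotheses (hM : fgproj M) (hN : fgproj N).
Hypotheses (hMr : fgproj (right_mod M)) (hNr : fgproj (right_mod N)).
Implicit Types (q : quad N M).

Lemma qexact_coker q1 q2 q3 (i : qhom q1 q2) (p : qhom q2 q3)
    (U1 U2 U3 : lmodType A) (u1 : {linear qX q1 -> U1})
    (u2 : {linear qX q2 -> U2}) (u3 : {linear qX q3 -> U3}) :
  qexact i p -> exact (qg q1) u1 -> exact (qg q2) u2 -> exact (qg q3) u3 ->
  exists (iU : {linear U1 -> U2}) (pU : {linear U2 -> U3}),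
    [/\ forall x, u2 (hX i x) = iU (u1 x), forall x, u3 (hX p x) = pU (u2 x) &
        exact iU pU].
Proof.
move=> [exX exY]; apply: nine_right exX => [t|t|].
- by rewrite hXgE.
- by rewrite hXgE.
- exact: tensor_exact.
Qed.

Lemma qcoker q1 q2 (i : qhom q1 q2) :
  injective (hX i) -> injective (hY i) ->
  exists q3 (p : qhom q2 q3), qexact i p.
Proof.
move=> /exact_coker[X3 [pX exX]] /exact_coker[Y3 [pY exY]].
have [g3 g3E] := map_coker hNr exX exY (hXg i).
have [f3 f3E] := map_coker hMr exY exX (hYf i).
by exists (Quad f3 g3), (@QHom _ _ _ _ _ q2 (Quad f3 g3) pX pY g3E f3E).
Qed.

Lemma qker q2 q3 (p : qhom q2 q3) :
  surj (hX p) -> surj (hY p) ->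
  exists q1 (i : qhom q1 q2), qexact i p.
Proof.
move=> /exact_ker exX /exact_ker exY.
have [g1 g1E] := map_ker hNr exX exY (hXg p).
have [f1 f1E] := map_ker hMr exY exX (hYf p).
by exists (Quad f1 g1), (@QHom _ _ _ _ _ (Quad f1 g1) q2 _ _ g1E f1E).
Qed.

(** A map from [q] to (D, 0) is a map on [qX q] that kills the image of [qg q], that is, a map from
    Coker g to [D]. *)
Definition quadX (D : lmodType A) : quad N M :=
  @Quad _ _ _ N M D (zeromod B) \0 \0.

Lemma quadX_compat_f q (D : lmodType A) (h : {linear qX q -> D}) m x :
  (\0 : {linear qY q -> zeromod B}) (qf q (tens m x)) = qf (quadX D) (tens m (h x)).
Proof. by []. Qed.

Definition homX q (D : lmodType A) (h : {linear qX q -> D})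
    (hg : forall n y, h (qg q (tens n y)) =
      qg (quadX D) (tens n ((\0 : {linear qY q -> zeromod B}) y))) :
    qhom q (quadX D) :=
  @QHom _ _ _ _ _ q (quadX D) h \0 hg (quadX_compat_f h).

(** The cokernel is left adjoint to D |-> (D, 0), which preserves surjections, so lifting problems
    for [U] become lifting problems for [q]. *)
Lemma coker_fgproj q (U : lmodType A) (u : {linear qX q -> U}) :
  qfgproj MN0 NM0 q -> exact (qg q) u -> fgproj U.
Proof.
move=> [/fg_span[s sE] /qliftsP lq] ex; have [_ su eu] := ex; split.
  apply/fg_span; exists [seq u z.1 | z <- s] => T T0 TD Ts x.
  have [y <-] := su x.
  apply: (sE (fun z => T (u z.1)) _ _ _ (y, 0)) => [|w z z' Tz Tz'|z zs] /=.
  - by rewrite linear0.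
  - by rewrite !linearD linearZ_LR (exact_comp0 _ ex) addr0; apply: TD.
  - exact/Ts/map_f.
move=> V W p h sp.
have p0 n y : p (qg (quadX V) (tens n y)) =
    qg (quadX W) (tens n ((\0 : {linear zeromod B -> zeromod B}) y)).
  by rewrite /= linear0.
have h0 n y : (h \o u) (qg q (tens n y)) =
    qg (quadX W) (tens n ((\0 : {linear qY q -> zeromod B}) y)).
  by rewrite /= (exact_comp0 _ ex) linear0.
have [|y|k [kX _]] := lq _ _ (homX (q := quadX V) p0) (homX h0).
- exact: sp.
- by exists 0; rewrite (zeromod0 y).
have [x /eu[t <-]|l lE] := @factor_surj _ _ _ _ u (hX k) su.
  by rewrite hXgE.
exists l => x; have [y <-] := su x; rewrite lE; exact: kX.
Qed.

(* (D, 0) is resolved by the projective quadruples (0, M (x) D) and (D, M (x) D). *)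
Lemma gp_extends_quadX q K P (i : qhom K P) (p : qhom P q) (D : lmodType A) :
  qgp MN0 NM0 q -> qexact i p -> fgproj D -> qextends i (quadX D).
Proof.
move=> gq ex hD.
have zX : zero_module (tensor N (tensor M D)) by exact: tensor_tensor0.
have zY : zero_module (tensor M (zeromod A)) by apply: tensor_zero; apply: zeromod0.
have zN : zero_module (tensor N (zeromod B)) by apply: tensor_zero; apply: zeromod0.
pose F1 := qfree N M (zeromod A) (tensor M D).
pose F2 := qfree N M D (zeromod B).
pose j : qhom F1 F2 := free_hom MN0 NM0 (q := F2) \0 (pairr (zeromod B) (tensor M D)).
have r0 n y : (@fst D (tensor N (zeromod B))) (qg F2 (tens n y)) =
    qg (quadX D) (tens n ((\0 : {linear qY F2 -> zeromod B}) y)).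
  by [].
pose r : qhom F2 (quadX D) := homX r0.
have exF : qexact j r.
  split; split.
  - move=> [x t] [x' t'] _; congr (_, _); first by rewrite (zeromod0 x) (zeromod0 x').
    by rewrite (zX t) (zX t').
  - by move=> d; exists (d, 0).
  - move=> [d t]; rewrite (zN t); split=> [/= ->|[[x w] <-]].
      by exists 0; exact: (etrans (add0r _) (congr1 (pair 0) (zN _))).
    by rewrite (zX w) (zeromod0 x) !linear0.
  - move=> [x t] [x' t'] /= e; have := congr1 snd e.
    rewrite (zY t) (zY t') !linear0 /= !addr0 => ->.
    by [].
  - by move=> d; exists 0; rewrite (zeromod0 d).
  - move=> [d t]; split=> // _; exists (t, 0).
    by rewrite /= !linear0 addr0 (zeromod0 d).
apply/(qextendsP MN0 NM0).
have [f1 f2] : qfgproj MN0 NM0 F1 /\ qfgproj MN0 NM0 F2.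
  by split; apply: qfree_fgproj => //; do ?[exact: fgproj_zero | exact: fgproj_tensor].
apply: (gp_ext0_pd1 gq f1 f2 (i := qmap MN0 NM0 j) (p := qmap MN0 NM0 r)).
  exact/qexactP.
by apply/qexactP; apply: ex.
Qed.

Lemma qgp_coker q (U : lmodType A) (u : {linear qX q -> U}) :
  qgp MN0 NM0 q -> exact (qg q) u -> gorenstein_projective U.
Proof.
move=> gq ex.
apply: (@gp_intro _ (fun U => exists q (u : {linear qX q -> U}),
  qgp MN0 NM0 q /\ exact (qg q) u)); last by exists q, u.
move=> {gq q U u ex} U [q [u [gq ex]]].
have [[P [q' [i [p [fP exq gq']]]]] [K [P' [i' [p' [fP' exq' gK e]]]]]] := qgp_unfold gq.
split.
  have [UP [uP exP]] := exact_coker (qfgproj_monic hNr fP).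
  have [U' [u' ex']] := exact_coker (qgp_monic hNr gq').
  have [iU [pU [_ _ exU]]] := qexact_coker exq ex exP ex'.
  exists UP, U', iU, pU; split=> //; first exact: coker_fgproj exP.
  by exists q', u'.
have [UP [uP exP]] := exact_coker (qfgproj_monic hNr fP').
have [UK [uK exK]] := exact_coker (qgp_monic hNr gK).
have [iU [pU [iUE _ exU]]] := qexact_coker exq' exK exP ex.
exists UK, UP, iU, pU; split=> //; first exact: coker_fgproj exP.
  by exists K, uK.
move=> D fD h.
(* A map from the cokernel of [K] into [D] is a map from [K] to (D, 0); it extends to [P'] and
   descends to the cokernel there. *)
have h0 n y : (h \o uK) (qg K (tens n y)) =
    qg (quadX D) (tens n ((\0 : {linear qY K -> zeromod B}) y)).
  by rewrite /= (exact_comp0 _ exK) linear0.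
have [k [kX _]] := gp_extends_quadX gq exq' fD (homX h0).
have [_ sP eP] := exP; have [_ sK eK] := exK.
have [x /eP[t <-]|l lE] := @factor_surj _ _ _ _ uP (hX k) sP.
  by rewrite hXgE.
by exists l => x; have [y <-] := sK x; rewrite -iUE lE kX.
Qed.

End Cokernels.

(** * Monic quadruples with Gorenstein-projective cokernels *)

Section OneSide.
Variables (R : comNzRingType) (A B : algType R).
Variables (N : bimodType A B) (M : bimodType B A).
Hypothesis NM0 : zero_module (tensor N M).
Hypothesis hNr : fgproj (right_mod N).
Implicit Types (q K T : quad N M).
Variables (P : lmodType A) (Q : lmodType B).

Section Next.
Variables (q : quad N M) (U U' : lmodType A) (V V' : lmodType B).
Variables (u : {linear qX q -> U}) (v : {linear qY q -> V}).
Variables (iU : {linear U -> P}) (pU : {linear P -> U'}).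
Variables (iV : {linear V -> Q}) (pV : {linear Q -> V'}).
Hypotheses (exu : exact (qg q) u) (exv : exact (qf q) v).
Hypotheses (exU : exact iU pU) (exV : exact iV pV).

(** The second component extends N (x) (iV \o v) along [qg q], possible as Ext^1(U, N (x) Q) = 0. If
    the first component of [a x] is zero, [x] comes from N (x) Y, where N (x) v and N (x) iV are
    injective. *)
Lemma next_embed : gorenstein_projective U -> fgproj (tensor N Q) ->
  exists a : {linear qX q -> (P * tensor N Q)%type},
    [/\ injective a, forall x, (a x).1 = iU (u x) &
        forall n y, a (qg q (tens n y)) = (0, tens n (iV (v y)))].
Proof.
move=> gU fQ.
have [b bE] := gp_ext0 gU fQ exu (tmap N (iV \o v)).
have aL : linear (fun x => (iU (u x), b x) : P * tensor N Q).
  by move=> c x y; rewrite !linearP.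
exists (mklin aL); split=> // [|n y]; last first.
  by rewrite /= (exact_comp0 _ exu) linear0 bE tmapE.
have [iiU _ _] := exU; have [_ _ eu] := exu.
have [iiV _ _] := tensor_exact hNr exV.
apply: linear_inj => x /= [] /(linear_inj0 iiU)/eu[t <-].
rewrite bE -(tmap_comp (h := v) (k := iV)) // => /(linear_inj0 iiV) t0.
by rewrite (linear_inj0 (tmap_coker_inj hNr NM0 exv) t0) linear0.
Qed.

(** The columns of [q] and of the free quadruple are exact, so [nine_bot] identifies the cokernel of
    [qg q'] with [U']. *)
Lemma next_coker q' (i : qhom q (qfree N M P Q)) (p : qhom (qfree N M P Q) q') :
  qexact i p -> (forall x, (hX i x).1 = iU (u x)) ->
  exists u' : {linear qX q' -> U'}, exact (qg q') u'.
Proof.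
move=> [exX exY] iE; have [_ sX eX] := exX.
have [z /eX[x <-]|u' u'E] := factor_surj (h := pU \o @fst P (tensor N Q)) sX.
  by rewrite /= iE (exact_comp0 _ exU).
exists u'; apply: (nine_bot (t12 := tmap N (hY i)) (t23 := tmap N (hY p))
  (x12 := hX i) (x23 := hX p) (u12 := iU) (u23 := pU) (g1 := qg q)
  (g2 := qg (qfree N M P Q)) (q1 := u) (q2 := @fst P (tensor N Q))) => //.
- by move=> t; rewrite hXgE.
- by move=> t; rewrite hXgE.
- exact: tensor_exact.
- exact: free_map_exact.
Qed.

End Next.

Section Prev.
Variables (q : quad N M) (U U' : lmodType A) (V V' : lmodType B).
Variables (u : {linear qX q -> U}) (v : {linear qY q -> V}).
Variables (iU : {linear U' -> P}) (pU : {linear P -> U}).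
Variables (pV : {linear Q -> V}).
Hypotheses (exu : exact (qg q) u) (exv : exact (qf q) v).
Hypotheses (exU : exact iU pU) (sV : surj pV).

(** Modulo the image of [qg q], [x] comes from [P]. The rest is reached from N (x) Q, because
    changing [y] by an element of the image of [qf q] does not affect [qg q (tens n y)]. *)
Lemma prev_surj (a : {linear P -> qX q}) (b : {linear Q -> qY q}) :
  (forall x, u (a x) = pU x) -> (forall y, v (b y) = pV y) ->
  surj (free_X (N := N) a b).
Proof.
move=> aE bE x; have [_ sU _] := exU; have [x' x'E] := sU (u x).
have [_ _ eu] := exu; have [_ _ ev] := exv.
have /eu[t tE] : u (x - a x') = 0 by rewrite linearB aE x'E subrr.
have [t' t'E] : exists t', qg q (tmap N b t') = qg q t.
  elim/tens_ind: t {tE} => [t1 t2 [t1' e1] [t2' e2]|n y].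
    by exists (t1' + t2'); rewrite !linearD e1 e2.
  have [y' y'E] := sV (v y).
  have /ev[s sE] : v (y - b y') = 0 by rewrite linearB bE y'E subrr.
  exists (tens n y'); rewrite tmapE -[y in RHS](subrK (b y')) -sE.
  by rewrite tensDr linearD (qgf0 NM0) add0r.
by exists (x', t'); rewrite /= t'E tE addrC subrK.
Qed.

Lemma prev_ker K (i : qhom K (qfree N M P Q)) (p : qhom (qfree N M P Q) q) :
  qexact i p -> (forall z, u (hX p z) = pU z.1) ->
  exists uK : {linear qX K -> U'},
    exact (qg K) uK /\ forall x, (hX i x).1 = iU (uK x).
Proof.
move=> [exX exY] pE; have [iiU _ eU] := exU.
have [x|uK uKE] := factor_inj (h := @fst P (tensor N Q) \o hX i) iiU.
  by apply/eU; rewrite /= -pE (exact_comp0 _ exX) linear0.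
exists uK; split=> //.
apply: (nine_top (t12 := tmap N (hY i)) (t23 := tmap N (hY p))
  (x12 := hX i) (x23 := hX p) (u12 := iU) (u23 := pU)
  (g2 := qg (qfree N M P Q)) (g3 := qg q) (q2 := @fst P (tensor N Q)) (q3 := u)) => //.
- by move=> t; rewrite hXgE.
- by move=> t; rewrite hXgE.
- exact: tensor_exact.
- exact: free_map_exact.
Qed.

End Prev.

Section Extend.
Variables (K T : quad N M) (i : qhom K (qfree N M P Q)).
Variables (UK UT : lmodType A) (VT : lmodType B).
Variables (uK : {linear qX K -> UK}) (uT : {linear qX T -> UT}).
Variables (vT : {linear qY T -> VT}) (iU : {linear UK -> P}).
Hypotheses (exK : exact (qg K) uK) (exT : exact (qg T) uT).
Hypothesis exTv : exact (qf T) vT.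
Hypothesis iE : forall x, (hX i x).1 = iU (uK x).

(** The map induced on cokernels extends to [P] and lifts to [qX T]; subtracting the lift pushes [h]
    into the image of [qg T]. *)
Lemma extend_coker (h : qhom K T) :
  projective P -> extends iU UT ->
  exists a : {linear P -> qX T},
    forall x, exists t, hX h x - a (hX i x).1 = qg T t.
Proof.
move=> pP eU; have [_ sK eK] := exK; have [_ sT eT] := exT.
have [x /eK[t <-]|l lE] := factor_surj (h := uT \o hX h) sK.
  by rewrite /= hXgE (exact_comp0 _ exT).
have [k kE] := eU l; have [a aE] := pP _ _ uT k sT.
exists a => x; have /eT[t tE] : uT (hX h x - a (hX i x).1) = 0.
  by rewrite linearB aE iE kE lE /= subrr.
by exists t.
Qed.

(** Here [h] factors as [qg T \o w], and [w] kills the image of [qg K] because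
    [qg T (tens n (qf T _))] is zero. So [w] factors through [UK], and it extends to [P] as its
    target is isomorphic to the projective module N (x) VT. *)
Lemma extend_image (h : qhom K T) :
  fgproj (tensor N VT) ->
  (forall Q', fgproj Q' -> extends iU Q') ->
  (forall x, exists t, hX h x = qg T t) ->
  (forall y, exists t, hY h y = qf T t) ->
  exists a : {linear P -> tensor N (qY T)},
    forall x, hX h x = qg T (a (hX i x).1).
Proof.
move=> fNV eU imX imY; have [_ sK eK] := exK; have [iT _ _] := exT.
have [x|w wE] := factor_inj (h := hX h) iT.
  by have [t ->] := imX x; exists t.
have [x /eK[t <-]|l lE] := factor_surj (h := w) sK.
  apply: (linear_inj0 iT); rewrite wE.
  elim/tens_ind: t => [t1 t2 h1 h2|n y]; first by rewrite !linearD h1 h2 addr0.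
  by rewrite hXg; have [s ->] := imY y; apply: qgf0.
have [_ sv _] := exTv.
have [j [j1 j2]] := linear_inv (tmap_coker_inj hNr NM0 exTv) (tmap_surj sv).
have fNT : fgproj (tensor N (qY T)).
  apply: (fgproj_iso _ _ fNV (j := j)); first exact: can_inj j2.
  by move=> t; exists (tmap N vT t).
have [a aE] := eU _ fNT l.
by exists a => x; rewrite iE aE lE wE.
Qed.

End Extend.

End OneSide.

(** Exactness includes that both structure maps are injective, and leaves the cokernels free up to
    isomorphism. *)
Definition monic_gp (R : comNzRingType) (A B : algType R) (N : bimodType A B)
    (M : bimodType B A) (q : quad N M) :=
  exists (U : lmodType A) (V : lmodType B)
    (u : {linear qX q -> U}) (v : {linear qY q -> V}),
    [/\ exact (qg q) u, exact (qf q) v,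
        gorenstein_projective U & gorenstein_projective V].

Section MonicGP.
Variables (R : comNzRingType) (A B : algType R).
Variables (N : bimodType A B) (M : bimodType B A).
Hypotheses (MN0 : zero_module (tensor M N)) (NM0 : zero_module (tensor N M)).
Hypotheses (hM : fgproj M) (hN : fgproj N).
Hypotheses (hMr : fgproj (right_mod M)) (hNr : fgproj (right_mod N)).
Implicit Types q : quad N M.

Lemma monic_gp_next q : monic_gp q -> has_qnext MN0 NM0 (@monic_gp R A B N M) q.
Proof.
move=> [U [V [u [v [exu exv gU gV]]]]].
have [[P [U' [iU [pU [fP exU gU']]]]] _] := gp_unfold gU.
have [[Q [V' [iV [pV [fQ exV gV']]]]] _] := gp_unfold gV.
have [a [ia a1 ag]] := next_embed NM0 hNr exu exv exU exV gU (fgproj_tensor hN fQ).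
have [b [ib b1 bf]] := next_embed (q := qswap q)
  MN0 hMr exv exu exV exU gV (fgproj_tensor hM fP).
have cX n y : a (qg q (tens n y)) = qg (qfree N M P Q) (tens n (b y)).
  by rewrite ag [RHS]free_mapE b1.
have cY m x : b (qf q (tens m x)) = qf (qfree N M P Q) (tens m (a x)).
  by rewrite bf [RHS]free_mapE a1.
pose i : qhom q (qfree N M P Q) := @QHom _ _ _ _ _ q (qfree N M P Q) a b cX cY.
have [q' [p ex]] := qcoker hMr hNr (i := i) ia ib.
have [u' exu'] := next_coker NM0 hNr exu exU ex a1.
have [v' exv'] := next_coker (q := qswap q) (q' := qswap q') MN0 hMr exv exV
  (i := hswap i) (p := hswap p) (conj ex.2 ex.1) b1.
exists (qfree N M P Q), q', i, p; split=> //; first exact: qfree_fgproj.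
by exists U', V', u', v'.
Qed.

Lemma monic_gp_prev q : monic_gp q -> has_qprev MN0 NM0 (@monic_gp R A B N M) q.
Proof.
move=> [U [V [u [v [exu exv gU gV]]]]].
have [_ [UK [P [iU [pU [fP exU gUK eU]]]]]] := gp_unfold gU.
have [_ [VK [Q [iV [pV [fQ exV gVK eV]]]]]] := gp_unfold gV.
have [_ su _] := exu; have [_ sv _] := exv.
have [_ sU _] := exU; have [_ sV _] := exV.
have [_ pP] := fP; have [_ pQ] := fQ.
have [a aE] := pP _ _ u pU su; have [b bE] := pQ _ _ v pV sv.
pose p : qhom (qfree N M P Q) q := free_hom MN0 NM0 a b.
have [|| K [i ex]] := qker hMr hNr (p := p).
- exact: (prev_surj NM0 exu exv exU sV aE bE).
- exact: (prev_surj (q := qswap q) MN0 exv exu exV sU bE aE).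
have [|uK [exuK iE]] := prev_ker NM0 hNr exu exU ex.
  by move=> z; rewrite /= linearD aE (exact_comp0 _ exu) addr0.
have [|vK [exvK jE]] := prev_ker (q := qswap q) (K := qswap K) MN0 hMr exv exV
  (i := hswap i) (p := hswap p) (conj ex.2 ex.1).
  by move=> z; rewrite /= linearD bE (exact_comp0 _ exv) addr0.
exists K, (qfree N M P Q), i, p; split=> //; first exact: qfree_fgproj.
  by exists UK, VK, uK, vK.
move=> T fT h.
have [UT [uT exT]] := exact_coker (qfgproj_monic hNr fT).
have [VT [vT exTv]] := exact_coker (qfgproj_monic hMr (qfgproj_swap fT)).
have fUT := coker_fgproj fT exT.
have fVT := coker_fgproj (qfgproj_swap fT) exTv.
have [a1 a1E] := extend_coker exuK exT iE h pP (eU _ fUT).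
have [b1 b1E] := extend_coker (K := qswap K) (T := qswap T) exvK exTv
  (i := hswap i) jE (hswap h) pQ (eV _ fVT).
(* The extension is built in two stages: [k1] agrees with [h] modulo the images of the structure
   maps of [T], and [k2] below extends the remainder [h']. *)
pose k1 := free_hom MN0 NM0 a1 b1.
pose h' := qsub h (qcomp i k1).
have imX x : exists t, hX h' x = qg T t.
  have [t tE] := a1E x; exists (t - tmap N b1 (hX i x).2).
  by rewrite /= linearB -tE opprD addrA.
have imY y : exists t, hY h' y = qf T t.
  have [t tE] := b1E y; exists (t - tmap M a1 (hY i y).2).
  by rewrite /= linearB -tE opprD addrA.
have [a2 a2E] := extend_image NM0 hNr exuK exT exTv iE
  (fgproj_tensor hN fVT) eU imX imY.
have [b2 b2E] := extend_image (K := qswap K) (T := qswap T) MN0 hMr exvK exTv exT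
  (i := hswap i) (h := hswap h') jE (fgproj_tensor hM fUT) eV imY imX.
pose k2 := free_hom MN0 NM0 (qg T \o a2) (qf T \o b2).
(* The cross terms of [k2] vanish, since composing the structure maps of [T] in either order gives
   zero. *)
have b20 t : qg T (tmap N (qf T \o b2) t) = 0.
  elim/tens_ind: t => [t1 t2|n y]; last by rewrite tmapE (qgf0 NM0).
  by rewrite !linearD => -> ->; rewrite addr0.
have a20 t : qf T (tmap M (qg T \o a2) t) = 0.
  elim/tens_ind: t => [t1 t2|m x]; last by rewrite tmapE; apply: (qgf0 MN0 (q := qswap T)).
  by rewrite !linearD => -> ->; rewrite addr0.
exists (qadd k1 k2); split=> [x|y].
  have -> : hX h x = hX k1 (hX i x) + hX h' x by rewrite /= addrC subrK.
  by rewrite a2E /= b20 addr0.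
have -> : hY h y = hY k1 (hY i y) + hY h' y by rewrite /= addrC subrK.
by rewrite b2E /= a20 addr0.
Qed.

Lemma monic_gp_qgp q : monic_gp q -> qgp MN0 NM0 q.
Proof.
apply: qgp_intro => {}q hq; split; first exact: monic_gp_next.
exact: monic_gp_prev.
Qed.

End MonicGP.

Theorem proposition1p4 (R : comNzRingType) (A B : algType R)
    (N : bimodType A B) (M : bimodType B A)
    (artA : artin_algebra A) (artB : artin_algebra B)
    (fgM : fg (base_mod M)) (fgN : fg (base_mod N))
    (artL : artin_algebra (morita N M))
    (MN0 : zero_module (tensor M N)) (NM0 : zero_module (tensor N M))
    (projBM : projective M) (projAN : projective N)
    (projMA : projective (right_mod M)) (projNB : projective (right_mod N))
    (X : lmodType A) (Y : lmodType B) (fgX : fg X) (fgY : fg Y)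
    (f : {linear tensor M X -> Y}) (g : {linear tensor N Y -> X}) :
  gorenstein_projective (quad_mod MN0 NM0 f g) <->
  [/\ quad_monic f g,
      gorenstein_projective (coker f) & gorenstein_projective (coker g)].
Proof.
have hM := fgproj_bimod fgM projBM; have hN := fgproj_bimod fgN projAN.
have hMr := fgproj_right_mod fgM projMA; have hNr := fgproj_right_mod fgN projNB.
pose q : quad N M := Quad f g.
split=> [gq|[[injf injg] gf gg]].
  have gq' : qgp MN0 NM0 q := gq.
  (* Each claim about [f] is the claim about [g] for the swapped quadruple. *)
  have injg := qgp_monic hNr gq'; have injf := qgp_monic hMr (qgp_swap gq').
  split=> //.
    exact: (qgp_coker hN hM hMr (qgp_swap gq') (exact_coker_linear injf)).
  exact: (qgp_coker hM hN hNr gq' (exact_coker_linear injg)).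
apply: (monic_gp_qgp MN0 NM0 hM hN hMr hNr (q := q)).
exists (coker g), (coker f), (coker_linear g), (coker_linear f).
by split=> //; apply: exact_coker_linear.
Qed.
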